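(* Let $G$ be a countable group and let $(\Theta_i)_{i\geq 1}$ be a sequence of sofic representations of $G$ such that the classes $[\Theta_i]$ are pairwise distinct extreme points of $Sof(G,P^\omega)$. Then there exists a decreasing chain of faces $F_1\supseteq F_2\supseteq F_3\supseteq\cdots$ in $Sof(G,P^\omega)$ with $\bigcap_{j\geq 1}F_j=\emptyset$.
   Context: Fix a free ultrafilter $\omega$ on $\mathbb{N}$. $M_n$ is the algebra of $n\times n$ complex matrices with normalised trace $Tr(x)=\frac1n\sum_i x(i,i)$ and $P_n\subset M_n$ is the group of permutation matrices, with normalised Hamming distance $d_H(p,q)=1-Tr(p^{-1}q)$. For natural numbers $n_k$ with $\lim_k n_k=\infty$, $\Pi_{k\to\omega}P_{n_k}$ is the group of sequences in $\prod_kP_{n_k}$ modulo the sequences with $\lim_{k\to\omega}d_H(p_k,Id)=0$, with $Tr(\Pi_{k\to\omega}p_k)=\lim_{k\to\omega}Tr(p_k)$. A sofic representation of $G$ is a group homomorphism $\Theta:G\to\Pi_{k\to\omega}P_{n_k}$ with $Tr(\Theta(g))=0$ for all $g\neq 1_G$ (different sofic representations may use different sequences of dimensions). Its amplification by positive integers $(r_k)_k$ is $\Theta\otimes Id_{r_k}:G\to\Pi_{k\to\omega}P_{n_kr_k}$. Two sofic representations $\Theta:G\to\Pi_{k\to\omega}P_{n_k}$ and $\Psi:G\to\Pi_{k\to\omega}P_{m_k}$ are equivalent if there are positive integers $r_k,t_k$ with $n_kr_k=m_kt_k$ such that $\Theta\otimes Id_{r_k}$ and $\Psi\otimes Id_{t_k}$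 are conjugate by an element of $\Pi_{k\to\omega}P_{n_kr_k}$. $[\Theta]$ is the class of $\Theta$, and $Sof(G,P^\omega)$ is the set of all classes. Convex structure: for $\lambda\in[0,1]$, $\lambda[\Theta]+(1-\lambda)[\Psi]$ is the class of $(\Theta\otimes Id_{r_k})\oplus(\Psi\otimes Id_{t_k})$, where $r_k,t_k$ are positive integers with $\lim_{k\to\omega}\frac{n_kr_k}{n_kr_k+m_kt_k}=\lambda$ (the class is independent of choices). A face is a nonempty convex subset $F\subset Sof(G,P^\omega)$ such that $\lambda[\Psi_1]+(1-\lambda)[\Psi_2]\in F$ with $0<\lambda<1$ implies $[\Psi_1],[\Psi_2]\in F$. $[\Theta]$ is an extreme point if $[\Theta]=\lambda[\Psi_1]+(1-\lambda)[\Psi_2]$ with $0<\lambda<1$ implies $[\Psi_1]=[\Psi_2]=[\Theta]$. *)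

(* Defs.v *)
From HB Require Import structures.
From mathcomp Require Import all_boot all_order all_algebra.
From mathcomp Require Import perm mxtens.
From mathcomp Require Import boolp classical_sets functions cardinality reals.
From mathcomp Require Import ring lra zify.
From mathcomp Require Import filter topology normedtype sequences.

Set Implicit Arguments.
Unset Strict Implicit.
Unset Printing Implicit Defensive.

Import Order.TTheory GRing.Theory Num.Theory.
Import numFieldNormedType.Exports.

Local Open Scope quotient_scope.
Local Open Scope classical_set_scope.
Local Open Scope ring_scope.

(* The group P_n is 'S_n, identified with permutation matrices by the morphism
   perm_mx (perm_mxM). Only traces of permutation matrices occur, and these are
   real, so real matrices are used. *)

Definition ntrace (R : realType) n (A : 'M[R]_n) : R := n%:R^-1 * \tr A.

Definition hamming (R : realType) n (p q : 'S_n) : R :=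
  1 - ntrace (perm_mx (p^-1 * q)%g).

Section FinitePermutations.
Context {R : realType}.

Lemma mxtrace_perm n (p : 'S_n) :
  \tr (perm_mx p : 'M[R]_n) = #|[set i | p i == i]%SET|%:R.
Proof.
rewrite /mxtrace (eq_bigr (fun i => (p i == i)%:R)); last first.
  by move=> i _; rewrite !mxE.
by rewrite -natr_sum -sum1dep_card [in RHS]big_mkcond; congr (_%:R); apply: eq_bigr => i _; case: eqP.
Qed.

Lemma hammingE n (p q : 'S_n) : (0 < n)%N ->
  hamming R p q = n%:R^-1 * #|[set i | p i != q i]%SET|%:R.
Proof.
move=> n0; rewrite /hamming /ntrace mxtrace_perm.
have -> : [set i | (p^-1 * q)%g i == i]%SET = p @: [set i | p i == q i]%SET.
  apply/setP => i; rewrite inE permM; apply/eqP/imsetP => [h|[j]].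
    by exists ((p^-1)%g i); rewrite ?inE permKV ?h.
  by rewrite inE => /eqP h ->; rewrite permK -h.
rewrite card_imset; last exact: perm_inj.
have -> : [set i | p i == q i]%SET = (~: [set i | p i != q i])%SET.
  by apply/setP => i; rewrite !inE negbK.
have := cardsC [set i | p i != q i]%SET; rewrite card_ord.
set a := #|_|; set b := #|_| => abn.
have n0' : n%:R != 0 :> R by rewrite pnatr_eq0 -lt0n.
have nE : n%:R = a%:R + b%:R :> R by rewrite -natrD abn.
have -> : b%:R = n%:R - a%:R :> R by rewrite nE addrC addKr.
by rewrite mulrBr mulVf// opprB addrC subrK.
Qed.


Lemma hammingxx n (p : 'S_n) : (0 < n)%N -> hamming R p p = 0.
Proof.
move=> n0; rewrite hammingE//.
rewrite (_ : [set i | _]%SET = finset.set0) ?cards0 ?mulr0//.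
by apply/setP => i; rewrite !inE eqxx.
Qed.

Lemma hamming_ge0 n (p q : 'S_n) : (0 < n)%N -> 0 <= hamming R p q.
Proof. by move=> n0; rewrite hammingE// mulr_ge0// invr_ge0. Qed.

Lemma hamming_le1 n (p q : 'S_n) : (0 < n)%N -> hamming R p q <= 1.
Proof.
move=> n0; rewrite hammingE// ler_pdivrMl ?ltr0n// mulr1 ler_nat.
by rewrite -[leqRHS]card_ord max_card.
Qed.

Lemma hammingC n (p q : 'S_n) : (0 < n)%N -> hamming R p q = hamming R q p.
Proof.
move=> n0; rewrite !hammingE//; congr (_ * _%:R).
by apply: eq_card => i; rewrite !inE eq_sym.
Qed.

Lemma hamming_tri n (p q s : 'S_n) : (0 < n)%N ->
  hamming R p s <= hamming R p q + hamming R q s.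
Proof.
move=> n0; rewrite !hammingE// -mulrDr ler_pM2l ?invr_gt0 ?ltr0n// -natrD ler_nat.
apply: leq_trans (leq_card_setU _ _); apply: subset_leq_card.
by apply/fintype.subsetP => i; rewrite !inE; apply: contraR; rewrite negb_or !negbK => /andP[/eqP-> /eqP->].
Qed.

Lemma hamming_mulr n (p q s : 'S_n) : (0 < n)%N ->
  hamming R (p * s)%g (q * s)%g = hamming R p q.
Proof.
move=> n0; rewrite !hammingE//; congr (_ * _%:R).
by apply: eq_card => i; rewrite !inE !permM (inj_eq perm_inj).
Qed.

Lemma hamming_mull n (p q s : 'S_n) : (0 < n)%N ->
  hamming R (s * p)%g (s * q)%g = hamming R p q.
Proof. by move=> n0; rewrite /hamming invgM mulgA mulgVK. Qed.

Lemma hammingM n (p q p' q' : 'S_n) : (0 < n)%N ->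
  hamming R (p * p')%g (q * q')%g <= hamming R p q + hamming R p' q'.
Proof.
move=> n0; apply: le_trans (hamming_tri _ (q * p')%g _ n0) _.
by rewrite hamming_mulr// hamming_mull.
Qed.

Lemma hammingV n (p q : 'S_n) : (0 < n)%N ->
  hamming R (p^-1)%g (q^-1)%g = hamming R p q.
Proof.
move=> n0; rewrite -(hamming_mull _ _ p)// mulgV -(hamming_mulr _ _ q)//.
by rewrite mulgVK mul1g hammingC.
Qed.

Lemma ntrace_hamming n (p : 'S_n) : ntrace (perm_mx p) = 1 - hamming R 1%g p.
Proof. by rewrite /hamming invg1 mul1g; ring. Qed.

Lemma ntrace_ge0 n (p : 'S_n) : (0 < n)%N -> 0 <= ntrace (perm_mx p) :> R.
Proof. by move=> n0; rewrite ntrace_hamming subr_ge0 hamming_le1. Qed.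

Lemma ntrace_le1 n (p : 'S_n) : (0 < n)%N -> ntrace (perm_mx p) <= 1 :> R.
Proof. by move=> n0; rewrite ntrace_hamming lerBlDr lerDl hamming_ge0. Qed.

End FinitePermutations.

Section TensorPermutations.
Variables (n r : nat).

Definition tens_perm_fun (p : 'S_n) (k : 'I_(n * r)) : 'I_(n * r) :=
  let ij := mxtens_unindex k in mxtens_index (p ij.1, ij.2).

Lemma tens_perm_fun_inj p : injective (tens_perm_fun p).
Proof.
move=> k l; case: (mxtens_indexP k) => i j; case: (mxtens_indexP l) => i' j'.
rewrite /tens_perm_fun !mxtens_indexK => /(can_inj (@mxtens_indexK _ _)).
by case=> /perm_inj -> ->.
Qed.

Definition tens_perm (p : 'S_n) : 'S_(n * r) := perm (@tens_perm_fun_inj p).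

Lemma tens_permE p i j :
  tens_perm p (mxtens_index (i, j)) = mxtens_index (p i, j).
Proof. by rewrite permE /tens_perm_fun mxtens_indexK. Qed.

Lemma tens_permM p q : tens_perm (p * q)%g = (tens_perm p * tens_perm q)%g.
Proof.
by apply/permP => k; case: (mxtens_indexP k) => i j; rewrite !(permM, tens_permE).
Qed.

Lemma tens_perm1 : tens_perm 1%g = 1%g.
Proof. by apply/permP => k; case: (mxtens_indexP k) => i j; rewrite tens_permE !perm1. Qed.

Lemma tens_permV p : tens_perm (p^-1)%g = ((tens_perm p)^-1)%g.
Proof.
by apply: (mulgI (tens_perm p)); rewrite -tens_permM !mulgV tens_perm1.
Qed.

Lemma perm_mx_tens (R : realType) p :
  perm_mx (tens_perm p) = perm_mx p *t 1%:M :> 'M[R]_(n * r).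
Proof.
apply/matrixP => k l; case: (mxtens_indexP k) => i j; case: (mxtens_indexP l) => i' j'.
rewrite tensmxE !mxE tens_permE (inj_eq (can_inj (@mxtens_indexK _ _))).
by rewrite -natrM mulnb.
Qed.

Lemma ntrace_tens (R : realType) p : (0 < r)%N ->
  ntrace (perm_mx (tens_perm p)) = ntrace (perm_mx p) :> R.
Proof.
move=> r0; rewrite /ntrace perm_mx_tens /mxtrace.
rewrite (reindex (@mxtens_index n r)); last first.
  by exists (@mxtens_unindex n r) => ? _; rewrite ?mxtens_indexK ?mxtens_unindexK.
rewrite (eq_bigr (fun ij => (perm_mx p : 'M[R]_n) ij.1 ij.1)); last first.
  by move=> [i j] _; rewrite tensmxE /= !mxE eqxx mulr1.
rewrite -(pair_bigA _ (fun i (j : 'I_r) => (perm_mx p : 'M[R]_n) i i)) /=.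
under eq_bigr do rewrite sumr_const card_ord.
rewrite sumrMnl -[_ *+ r]mulr_natr natrM invfM mulrACA mulVf ?mulr1//.
by rewrite pnatr_eq0 -lt0n.
Qed.

Lemma hamming_tens (R : realType) p q : (0 < r)%N ->
  hamming R (tens_perm p) (tens_perm q) = hamming R p q.
Proof. by move=> r0; rewrite /hamming -tens_permV -tens_permM ntrace_tens. Qed.

End TensorPermutations.

Section SumPermutations.
Variables (n m : nat).

Definition sum_perm_fun (p : 'S_n) (q : 'S_m) (k : 'I_(n + m)) : 'I_(n + m) :=
  match fintype.split k with
  | inl i => lshift m (p i)
  | inr j => rshift n (q j)
  end.

Lemma sum_perm_fun_inj p q : injective (sum_perm_fun p q).
Proof.
move=> k l; rewrite /sum_perm_fun.
by case: split_ordP => i ->; case: split_ordP => j -> /eqP;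
  rewrite ?eq_shift => // /eqP/perm_inj ->.
Qed.

Definition sum_perm (p : 'S_n) (q : 'S_m) : 'S_(n + m) :=
  perm (@sum_perm_fun_inj p q).

Lemma sum_perml p q i : sum_perm p q (lshift m i) = lshift m (p i).
Proof. by rewrite permE /sum_perm_fun (unsplitK (inl i)). Qed.

Lemma sum_permr p q j : sum_perm p q (rshift n j) = rshift n (q j).
Proof. by rewrite permE /sum_perm_fun (unsplitK (inr j)). Qed.

Lemma sum_permM p p' q q' :
  sum_perm (p * p')%g (q * q')%g = (sum_perm p q * sum_perm p' q')%g.
Proof.
by apply/permP => k; case: (split_ordP k) => i ->;
  rewrite !(permM, sum_perml, sum_permr).
Qed.

Lemma sum_perm1 : sum_perm 1%g 1%g = 1%g.
Proof.
by apply/permP => k; case: (split_ordP k) => i ->;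
  rewrite !(perm1, sum_perml, sum_permr).
Qed.

Lemma sum_permV p q : sum_perm (p^-1)%g (q^-1)%g = ((sum_perm p q)^-1)%g.
Proof.
by apply: (mulgI (sum_perm p q)); rewrite -sum_permM !mulgV sum_perm1.
Qed.

Lemma perm_mx_sum (R : realType) p q :
  perm_mx (sum_perm p q) = block_mx (perm_mx p) 0 0 (perm_mx q)
    :> 'M[R]_(n + m).
Proof.
apply/matrixP => k l; case: (split_ordP k) => i ->; case: (split_ordP l) => j ->;
by rewrite ?(block_mxEul, block_mxEur, block_mxEdl, block_mxEdr) !mxE
  ?(sum_perml, sum_permr) eq_shift.
Qed.

Lemma ntrace_sum_le (R : realType) p q : (0 < n)%N -> (0 < m)%N ->
  ntrace (perm_mx (sum_perm p q)) <=
  ntrace (perm_mx p) + ntrace (perm_mx q) :> R.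
Proof.
move=> n0 m0; rewrite /ntrace perm_mx_sum mxtrace_block mulrDr !mxtrace_perm.
apply: lerD; apply: ler_wpM2r => //; rewrite lef_pV2 ?posrE ?ltr0n ?addn_gt0 ?n0//.
  by rewrite ler_nat leq_addr.
by rewrite ler_nat leq_addl.
Qed.

Lemma hamming_sum_le (R : realType) p p' q q' : (0 < n)%N -> (0 < m)%N ->
  hamming R (sum_perm p q) (sum_perm p' q') <= hamming R p p' + hamming R q q'.
Proof.
move=> n0 m0; rewrite /hamming -sum_permV -sum_permM.
set s := (p^-1 * p')%g; set t := (q^-1 * q')%g.
rewrite /ntrace perm_mx_sum mxtrace_block !mxtrace_perm.
set a := #|_|; set b := #|_|.
have ha : a%:R <= n%:R :> R by rewrite ler_nat -[leqRHS]card_ord max_card.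
have hb : b%:R <= m%:R :> R by rewrite ler_nat -[leqRHS]card_ord max_card.
have hn : 0 < n%:R :> R by rewrite ltr0n.
have hm : 0 < m%:R :> R by rewrite ltr0n.
rewrite natrD.
have -> : 1 - (n%:R + m%:R)^-1 * (a%:R + b%:R) =
  (n%:R + m%:R)^-1 * (n%:R - a%:R) + (n%:R + m%:R)^-1 * (m%:R - b%:R) :> R.
  by field; rewrite lt0r_neq0// addr_gt0.
have -> : 1 - n%:R^-1 * a%:R = n%:R^-1 * (n%:R - a%:R) :> R.
  by field; rewrite lt0r_neq0.
have -> : 1 - m%:R^-1 * b%:R = m%:R^-1 * (m%:R - b%:R) :> R.
  by field; rewrite lt0r_neq0.
apply: lerD; apply: ler_wpM2r; rewrite ?subr_ge0// lef_pV2 ?posrE ?addr_gt0//; lra.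
Qed.

End SumPermutations.

(* Sequences of dimensions; the normalised trace requires n_k >= 1. *)
Record dimseq := DimSeq {
  dim :> nat -> nat;
  dim_gt0 : forall k, (0 < dim k)%N;
  dim_cvgy : dim @ \oo --> \oo
}.

Record multseq := MultSeq {
  mult :> nat -> nat;
  mult_gt0 : forall k, (0 < mult k)%N
}.

Lemma dim_mul_gt0 (n : dimseq) (r : multseq) k : (0 < n k * r k)%N.
Proof. by rewrite muln_gt0 dim_gt0 mult_gt0. Qed.

Lemma dim_mul_cvgy (n : dimseq) (r : multseq) :
  (fun k => n k * r k)%N @ \oo --> \oo.
Proof.
apply/cvgnyPge => A; have /cvgnyPge/(_ A) := dim_cvgy n.
by apply: filterS => k /leq_trans; apply; rewrite leq_pmulr ?mult_gt0.
Qed.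

Definition dim_mul (n : dimseq) (r : multseq) : dimseq :=
  DimSeq (dim_mul_gt0 n r) (@dim_mul_cvgy n r).

Lemma dim_add_gt0 (n m : dimseq) k : (0 < n k + m k)%N.
Proof. by rewrite addn_gt0 dim_gt0. Qed.

Lemma dim_add_cvgy (n m : dimseq) : (fun k => n k + m k)%N @ \oo --> \oo.
Proof.
apply/cvgnyPge => A; have /cvgnyPge/(_ A) := dim_cvgy n.
by apply: filterS => k /leq_trans; apply; rewrite leq_addr.
Qed.

Definition dim_add (n m : dimseq) : dimseq :=
  DimSeq (dim_add_gt0 n m) (@dim_add_cvgy n m).

Section Ultraproduct.
Context (R : realType) (omega : set_system nat) {omegaU : UltraFilter omega}.

Section OneSequence.
Context (n : dimseq).

Definition permseq := forall k, 'S_(n k).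
HB.instance Definition _ := Choice.on permseq.

(* Equality modulo the sequences p with lim d_H(p_k, Id) = 0: by left invariance
   (hamming_mull), d_H(p_k, q_k) = d_H(p_k^-1 * q_k, Id). *)
Definition ueq (p q : permseq) : bool :=
  `[< (fun k => hamming R (p k) (q k)) @ omega --> (0 : R) >].

Lemma ueq_refl : reflexive ueq.
Proof.
move=> p; apply/asboolP; under eq_fun do rewrite hammingxx ?dim_gt0//.
exact: cvg_cst.
Qed.

Lemma ueq_sym : symmetric ueq.
Proof.
move=> p q; rewrite /ueq.
suff -> : (fun k => hamming R (p k) (q k)) = (fun k => hamming R (q k) (p k)).
  by [].
by apply/funext => k; rewrite hammingC ?dim_gt0.
Qed.

Lemma ueq_trans : transitive ueq.
Proof.
move=> q p s /asboolP pq /asboolP qs; apply/asboolP.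
apply: (@squeeze_cvgr _ _ _ _ (fun=> 0)
  (fun k => hamming R (p k) (q k) + hamming R (q k) (s k))).
- by apply: nearW => k; rewrite hamming_ge0 ?hamming_tri ?dim_gt0.
- exact: cvg_cst.
- by rewrite -[0]addr0; apply: cvgD.
Qed.

Canonical ueq_equiv := EquivRel ueq ueq_refl ueq_sym ueq_trans.

Definition uprod := {eq_quot ueq}.
HB.instance Definition _ := Choice.on uprod.
HB.instance Definition _ := EqQuotient.on uprod.

Definition upi : permseq -> uprod := \pi_uprod.

Lemma upiP p q : reflect (upi p = upi q) (ueq p q).
Proof. exact: eqmodP. Qed.

Lemma upi_repr x : upi (repr x) = x.
Proof. exact: reprK. Qed.

Definition umul (x y : uprod) : uprod :=
  upi (fun k => repr x k * repr y k)%g.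
Definition uinv (x : uprod) : uprod := upi (fun k => (repr x k)^-1)%g.
Definition uone : uprod := upi (fun k => 1)%g.

Lemma repr_upi p : ueq (repr (upi p)) p.
Proof. by apply/upiP; rewrite upi_repr. Qed.

Lemma umulE p q : umul (upi p) (upi q) = upi (fun k => p k * q k)%g.
Proof.
apply/upiP/asboolP.
have /asboolP hp := repr_upi p; have /asboolP hq := repr_upi q.
apply: (@squeeze_cvgr _ _ _ _ (fun=> 0)
  (fun k => hamming R (repr (upi p) k) (p k) + hamming R (repr (upi q) k) (q k))).
- by apply: nearW => k; rewrite hamming_ge0 ?hammingM ?dim_gt0.
- exact: cvg_cst.
- by rewrite -[0]addr0; apply: cvgD.
Qed.

Lemma uinvE p : uinv (upi p) = upi (fun k => (p k)^-1)%g.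
Proof.
apply/upiP/asboolP; have /asboolP := repr_upi p.
by under eq_fun do rewrite -hammingV ?dim_gt0//.
Qed.

Lemma uprodW (P : uprod -> Prop) : (forall p, P (upi p)) -> forall x, P x.
Proof. by move=> h x; rewrite -[x]upi_repr. Qed.

Lemma umulA : associative umul.
Proof.
elim/uprodW=> p; elim/uprodW=> q; elim/uprodW=> s; rewrite !umulE.
by congr upi; apply: functional_extensionality_dep => k; rewrite mulgA.
Qed.

Lemma umul1 : left_id uone umul.
Proof.
elim/uprodW=> p; rewrite umulE.
by congr upi; apply: functional_extensionality_dep => k; rewrite mul1g.
Qed.

Lemma umulr1 : right_id uone umul.
Proof.
elim/uprodW=> p; rewrite umulE.
by congr upi; apply: functional_extensionality_dep => k; rewrite mulg1.
Qed.

Lemma umulV : left_inverse uone uinv umul.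
Proof.
elim/uprodW=> p; rewrite uinvE umulE.
by congr upi; apply: functional_extensionality_dep => k; rewrite mulVg.
Qed.

Lemma umulrV : right_inverse uone uinv umul.
Proof.
elim/uprodW=> p; rewrite uinvE umulE.
by congr upi; apply: functional_extensionality_dep => k; rewrite mulgV.
Qed.

HB.instance Definition _ :=
  isGroup.Build uprod umulA umul1 umulr1 umulV umulrV.

Lemma upiM p q : upi (fun k => p k * q k)%g = (upi p * upi q)%g.
Proof. by rewrite -umulE. Qed.

Lemma upi1 : upi (fun k => 1%g) = 1%g.
Proof. by []. Qed.

Lemma upiV p : upi (fun k => (p k)^-1)%g = (upi p)^-1%g.
Proof. by rewrite -uinvE. Qed.

(* The limit always exists and does not depend on the representative, see
   utrace_upi. *)
Definition utrace (x : uprod) : R :=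
  lim ((fun k => ntrace (perm_mx (repr x k))) @ omega).

Lemma utrace_upi p :
  (fun k => ntrace (perm_mx (p k))) @ omega --> utrace (upi p).
Proof.
have cv (q : permseq) : cvg ((fun k => ntrace (perm_mx (q k)) : R) @ omega).
  have := @segment_compact R 0 1; rewrite compact_ultra => /(_ (_ @ omega)).
  move=> /(_ (fun k => ntrace (perm_mx (q k)))) h.
  have [||x [_ hx]] := h.
  - split; first exact: fmap_proper_filter.
    move=> G GF le; apply/seteqP; split=> // A GA.
    have [//|nA] := in_ultra_setVsetC ((fun k => ntrace (perm_mx (q k)) : R) @^-1` A) omegaU.
    have /le GnA : ((fun k => ntrace (perm_mx (q k)) : R) @ omega) (~` A) by exact: nA.
    have : G set0 by rewrite -(setICr A); exact: filterI.
    by move/(@filter_not_empty _ G GF).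
  - by apply: nearW => k /=; rewrite in_itv/= ntrace_ge0 ?ntrace_le1 ?dim_gt0.
  by apply/cvg_ex; exists x.
pose a k : R := ntrace (perm_mx (repr (upi p) k)).
pose b k : R := ntrace (perm_mx (p k)).
suff h : (fun k => a k - b k) @ omega --> (0 : R).
  rewrite -/b (_ : b = a \- (fun k => a k - b k)); last first.
    by apply/funext => k /=; rewrite subKr.
  by rewrite /utrace -[lim _]subr0; exact: cvgB (cv (repr (upi p))) h.
have /asboolP hp := repr_upi p.
apply/cvgr0Pnorm_le => e e0; move/cvgr0Pnorm_le: hp => /(_ e e0).
apply: filterS => k; apply: le_trans.
rewrite (ger0_norm (hamming_ge0 _ _ (dim_gt0 n k))) /a /b !ntrace_hamming.
have := hamming_tri (R := R) 1%g (repr (upi p) k) (p k) (dim_gt0 n k).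
have := hamming_tri (R := R) 1%g (p k) (repr (upi p) k) (dim_gt0 n k).
rewrite [hamming R (p k) _]hammingC ?dim_gt0// => h1 h2.
rewrite ler_norml; lra.
Qed.

Lemma utraceE p l :
  (fun k => ntrace (perm_mx (p k))) @ omega --> (l : R) -> utrace (upi p) = l.
Proof.
move=> h; have := @utrace_upi p; move/(cvg_lim (@Rhausdorff R)) <-.
exact: (cvg_lim (@Rhausdorff R)).
Qed.

End OneSequence.

Section Maps.
Implicit Types (n m : dimseq) (r s : multseq).

(* ucast transports along an equality of dimension sequences; utens r is
   x |-> x (x) Id_(r_k), see utensE and perm_mx_tens; usum is the direct sum, see
   usumE and perm_mx_sum. *)
Definition ucast n m (e : forall k, n k = m k) (x : uprod n) : uprod m :=
  upi (fun k => cast_perm (e k) (repr x k) : 'S_(m k)).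

Definition utens n r (x : uprod n) : uprod (dim_mul n r) :=
  upi (n := dim_mul n r) (fun k => tens_perm (r k) (repr x k)).

Definition usum n m (x : uprod n) (y : uprod m) : uprod (dim_add n m) :=
  upi (n := dim_add n m) (fun k => sum_perm (repr x k) (repr y k)).

Lemma hamming_cast a b (e : a = b) (p q : 'S_a) :
  hamming R (cast_perm e p) (cast_perm e q) = hamming R p q.
Proof. by case: b / e; rewrite !cast_perm_id. Qed.

Lemma ucastE n m (e : forall k, n k = m k) (p : permseq n) :
  ucast e (upi p) = upi (fun k => cast_perm (e k) (p k) : 'S_(m k)).
Proof.
apply/upiP/asboolP; have /asboolP := repr_upi p.
by under eq_fun do rewrite -(hamming_cast (e _)).
Qed.

Lemma utensE n r (p : permseq n) :
  utens r (upi p) = upi (n := dim_mul n r) (fun k => tens_perm (r k) (p k)).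
Proof.
apply/upiP/asboolP; have /asboolP := repr_upi p.
by under eq_fun => k do rewrite -(@hamming_tens _ (r k) R _ _ (mult_gt0 r k)).
Qed.

Lemma usumE n m (p : permseq n) (q : permseq m) :
  usum (upi p) (upi q) =
  upi (n := dim_add n m) (fun k => sum_perm (p k) (q k)).
Proof.
apply/upiP/asboolP.
have /asboolP hp := repr_upi p; have /asboolP hq := repr_upi q.
apply: (@squeeze_cvgr _ _ _ _ (fun=> 0)
  (fun k => hamming R (repr (upi p) k) (p k) + hamming R (repr (upi q) k) (q k))).
- apply: nearW => k; rewrite hamming_ge0 ?(dim_gt0 (dim_add n m))//=.
  by rewrite hamming_sum_le ?dim_gt0.
- exact: cvg_cst.
- by rewrite -[0]addr0; apply: cvgD.
Qed.

Lemma ucast_id n (e : forall k, n k = n k) (x : uprod n) : ucast e x = x.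
Proof.
elim/uprodW: x => p; rewrite ucastE.
by congr upi; apply: functional_extensionality_dep => k; rewrite cast_perm_id.
Qed.

Lemma ucast_comp n m n' (e : forall k, n k = m k) (e' : forall k, m k = n' k)
    (e'' : forall k, n k = n' k) (x : uprod n) :
  ucast e' (ucast e x) = ucast e'' x.
Proof.
elim/uprodW: x => p; rewrite !ucastE.
congr upi; apply: functional_extensionality_dep => k.
by rewrite cast_perm_comp; congr cast_perm; exact: Prop_irrelevance.
Qed.

Lemma utens_cast n m r (e : forall k, n k = m k)
    (e' : forall k, dim_mul n r k = dim_mul m r k) (x : uprod n) :
  utens r (ucast e x) = ucast e' (utens r x).
Proof.
elim/uprodW: x => p; rewrite ucastE !utensE ucastE.
congr upi; apply: functional_extensionality_dep => k.
move: (e k) (e' k) => /=; case: (m k) / => ek.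
by rewrite !cast_perm_id.
Qed.

Lemma mult_mul_gt0 r s k : (0 < r k * s k)%N.
Proof. by rewrite muln_gt0 !mult_gt0. Qed.

Definition mult_mul r s : multseq := MultSeq (mult_mul_gt0 r s).

Lemma utensA n r s
    (e : forall k, dim_mul (dim_mul n r) s k = dim_mul n (mult_mul r s) k)
    (x : uprod n) :
  ucast e (utens s (utens r x)) = utens (mult_mul r s) x.
Proof.
elim/uprodW: x => p; rewrite !utensE ucastE.
congr upi; apply: functional_extensionality_dep => k.
apply/permP => i; rewrite cast_permE.
case: (mxtens_indexP i) => a bc; case: (mxtens_indexP bc) => b c.
have E d : cast_ord (esym (e k)) (mxtens_index (d, mxtens_index (b, c))) =
    mxtens_index (mxtens_index (d, b), c).
  by apply: val_inj => /=; rewrite mulnA mulnDl addnA.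
by rewrite E !tens_permE -E cast_ordKV.
Qed.

Lemma utensC n r s
    (e : forall k, dim_mul n (mult_mul r s) k = dim_mul n (mult_mul s r) k)
    (x : uprod n) :
  ucast e (utens (mult_mul r s) x) = utens (mult_mul s r) x.
Proof.
elim/uprodW: x => p; rewrite !utensE ucastE.
congr upi; apply: functional_extensionality_dep => k.
move: (e k) => /=; rewrite (mulnC (r k)) => ek.
by rewrite cast_perm_id.
Qed.

Lemma ucastM n m (e : forall k, n k = m k) :
  {morph ucast e : x y / (x * y)%g}.
Proof.
elim/uprodW=> p; elim/uprodW=> q; rewrite -(upiM p q) !ucastE -upiM.
by congr upi; apply: functional_extensionality_dep => k; rewrite cast_perm_morphM.
Qed.

Lemma utensM n r : {morph @utens n r : x y / (x * y)%g}.
Proof.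
elim/uprodW=> p; elim/uprodW=> q; rewrite -(upiM p q) !utensE -upiM.
by congr upi; apply: functional_extensionality_dep => k; rewrite tens_permM.
Qed.

Lemma ucastJ n m (e : forall k, n k = m k) (x u : uprod n) :
  ucast e (x ^ u)%g = (ucast e x ^ ucast e u)%g.
Proof.
apply: (mulgI (ucast e u)).
by rewrite -ucastM !conjgE !mulgA !mulgV !mul1g ucastM.
Qed.

Lemma utensJ n r (x u : uprod n) :
  utens r (x ^ u)%g = (utens r x ^ utens r u)%g.
Proof.
apply: (mulgI (utens r u)).
by rewrite -utensM !conjgE !mulgA !mulgV !mul1g utensM.
Qed.

Lemma usumM n m (x x' : uprod n) (y y' : uprod m) :
  usum (x * x')%g (y * y')%g = (usum x y * usum x' y')%g.
Proof.
elim/uprodW: x => p; elim/uprodW: x' => p'.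
elim/uprodW: y => q; elim/uprodW: y' => q'; rewrite -(upiM p p') -(upiM q q') !usumE -upiM.
by congr upi; apply: functional_extensionality_dep => k; rewrite sum_permM.
Qed.

Lemma utrace_tens n r (x : uprod n) : utrace (utens r x) = utrace x.
Proof.
elim/uprodW: x => p; rewrite utensE; apply: utraceE.
by under eq_fun do rewrite ntrace_tens ?mult_gt0//; exact: utrace_upi.
Qed.

Lemma utrace_sum0 n m (x : uprod n) (y : uprod m) :
  utrace x = 0 -> utrace y = 0 -> utrace (usum x y) = 0.
Proof.
elim/uprodW: x => p; elim/uprodW: y => q p0 q0; rewrite usumE.
have hp := @utrace_upi n p; have hq := @utrace_upi m q.
rewrite p0 in hp; rewrite q0 in hq; apply: utraceE.
apply: (@squeeze_cvgr _ _ _ _ (fun=> 0)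
  (fun k => ntrace (perm_mx (p k)) + ntrace (perm_mx (q k)))).
- apply: nearW => k; rewrite ntrace_ge0 ?(dim_gt0 (dim_add n m))//=.
  by rewrite ntrace_sum_le ?dim_gt0.
- exact: cvg_cst.
- by rewrite -[0]addr0; apply: cvgD.
Qed.

End Maps.
End Ultraproduct.

Arguments uprod R omega {omegaU} n.

Section SoficRepresentations.
Context (R : realType) (omega : set_system nat) {omegaU : UltraFilter omega}.
Context (G : groupType).

Record soficRep := SoficRep {
  sdim : dimseq;
  srep :> {multiplicative G -> uprod R omega sdim};
  srep_trace : forall g, g != 1%g -> utrace (srep g) = 0
}.

Section Amplification.
Context (Theta : soficRep) (r : multseq).

Definition amp_fun (g : G) := utens r (Theta g).

Lemma amp_funM : {morph amp_fun : g h / (g * h)%g}.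
Proof. by move=> g h; rewrite /amp_fun gmulfM utensM. Qed.

HB.instance Definition _ := isMultiplicative.Build _ _ amp_fun amp_funM.

Lemma amp_trace g : g != 1%g -> utrace (amp_fun g) = 0.
Proof. by move=> g1; rewrite utrace_tens srep_trace. Qed.

Definition amp : soficRep := @SoficRep (dim_mul _ r) amp_fun amp_trace.

End Amplification.

Section DirectSum.
Context (Theta Psi : soficRep).

Definition dsum_fun (g : G) := usum (Theta g) (Psi g).

Lemma dsum_funM : {morph dsum_fun : g h / (g * h)%g}.
Proof. by move=> g h; rewrite /dsum_fun !gmulfM usumM. Qed.

HB.instance Definition _ := isMultiplicative.Build _ _ dsum_fun dsum_funM.

Lemma dsum_trace g : g != 1%g -> utrace (dsum_fun g) = 0.
Proof. by move=> g1; rewrite utrace_sum0 ?srep_trace. Qed.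

Definition dsum : soficRep :=
  @SoficRep (dim_add _ _) dsum_fun dsum_trace.

End DirectSum.

Definition conjugate_reps (Theta Psi : soficRep) : Prop :=
  exists (e : forall k, sdim Theta k = sdim Psi k)
         (u : uprod R omega (sdim Psi)),
    forall g, ucast e (Theta g) = (Psi g ^ u)%g.

Lemma conjugate_refl Theta : conjugate_reps Theta Theta.
Proof. by exists (fun=> erefl), 1%g => g; rewrite ucast_id conjg1. Qed.

Lemma conjugate_sym Theta Psi :
  conjugate_reps Theta Psi -> conjugate_reps Psi Theta.
Proof.
move=> [e [u h]].
exists (fun k => esym (e k)), (ucast (fun k => esym (e k)) u^-1%g) => g.
rewrite -[Psi g](conjgK u) -h ucastJ.
by rewrite (ucast_comp _ _ (fun=> erefl)) ucast_id.
Qed.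

Lemma conjugate_trans Theta Psi Phi :
  conjugate_reps Theta Psi -> conjugate_reps Psi Phi ->
  conjugate_reps Theta Phi.
Proof.
move=> [e [u h]] [e' [w h']].
exists (fun k => etrans (e k) (e' k)), (w * ucast e' u)%g => g.
by rewrite -(ucast_comp e e') h ucastJ h' conjgM.
Qed.

Lemma conjugate_amp Theta Psi r :
  conjugate_reps Theta Psi -> conjugate_reps (amp Theta r) (amp Psi r).
Proof.
move=> [e [u h]].
have e' k : sdim (amp Theta r) k = sdim (amp Psi r) k by rewrite /= e.
exists e', (utens r u) => g.
by rewrite -[amp Psi r g]/(utens r (Psi g)) -utensJ -h -utens_cast.
Qed.

Lemma conjugate_ampA Theta r s :
  conjugate_reps (amp (amp Theta r) s) (amp Theta (mult_mul r s)).
Proof.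
have e k : sdim (amp (amp Theta r) s) k = sdim (amp Theta (mult_mul r s)) k.
  by rewrite /= mulnA.
by exists e, 1%g => g; rewrite conjg1; exact: utensA.
Qed.

Lemma conjugate_ampC Theta r s :
  conjugate_reps (amp Theta (mult_mul r s)) (amp Theta (mult_mul s r)).
Proof.
have e k : sdim (amp Theta (mult_mul r s)) k = sdim (amp Theta (mult_mul s r)) k.
  by rewrite /= (mulnC (r k)).
by exists e, 1%g => g; rewrite conjg1; exact: utensC.
Qed.

Lemma mult_one_gt0 (k : nat) : (0 < 1)%N.
Proof. by []. Qed.

Definition mult_one : multseq := MultSeq mult_one_gt0.

HB.instance Definition _ := gen_eqMixin soficRep.
HB.instance Definition _ := gen_choiceMixin soficRep.

Definition sofic_equiv (Theta Psi : soficRep) : bool :=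
  `[< exists r t : multseq, conjugate_reps (amp Theta r) (amp Psi t) >].

Lemma sofic_equiv_refl : reflexive sofic_equiv.
Proof.
by move=> Theta; apply/asboolP; exists mult_one, mult_one; exact: conjugate_refl.
Qed.

Lemma sofic_equiv_sym : symmetric sofic_equiv.
Proof.
by move=> Theta Psi; apply/asboolP/asboolP => -[r [t h]]; exists t, r;
  exact: conjugate_sym.
Qed.

Lemma sofic_equiv_trans : transitive sofic_equiv.
Proof.
move=> Psi Theta Phi /asboolP[r [t h]] /asboolP[s [v h']]; apply/asboolP.
exists (mult_mul r s), (mult_mul v t).
apply: conjugate_trans (conjugate_ampA _ _ _).
apply: conjugate_trans (conjugate_amp t h').
apply: conjugate_trans (conjugate_sym (conjugate_ampA _ _ _)).
apply: conjugate_trans (conjugate_ampC _ _ _).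
apply: conjugate_trans (conjugate_ampA _ _ _).
by apply: conjugate_trans (conjugate_amp s h); apply/conjugate_sym/conjugate_ampA.
Qed.

Canonical sofic_equiv_equiv :=
  EquivRel sofic_equiv sofic_equiv_refl sofic_equiv_sym sofic_equiv_trans.

Definition Sof := {eq_quot sofic_equiv}.
HB.instance Definition _ := Choice.on Sof.
HB.instance Definition _ := EqQuotient.on Sof.

Definition sclass : soficRep -> Sof := \pi_Sof.

Lemma sclassP Theta Psi :
  sclass Theta = sclass Psi <->
  exists r t : multseq, conjugate_reps (amp Theta r) (amp Psi t).
Proof. by split => [/eqmodP/asboolP|h]//; apply/eqmodP/asboolP. Qed.

(* c = lambda a + (1 - lambda) b, for any choice of representatives and of
   multiplicities; all choices give the same class c. *)
Definition is_convex_comb (lambda : R) (a b c : Sof) : Prop :=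
  exists (Theta Psi : soficRep) (r t : multseq),
    [/\ a = sclass Theta, b = sclass Psi,
      (fun k => (sdim Theta k * r k)%:R /
                (sdim Theta k * r k + sdim Psi k * t k)%:R) @ omega --> lambda
    & c = sclass (dsum (amp Theta r) (amp Psi t))].

Definition is_convex (F : set Sof) : Prop :=
  forall lambda a b c, 0 <= lambda <= 1 -> is_convex_comb lambda a b c ->
  F a -> F b -> F c.

Definition is_face (F : set Sof) : Prop :=
  [/\ F !=set0, is_convex F
    & forall lambda a b c, 0 < lambda < 1 -> is_convex_comb lambda a b c ->
      F c -> F a /\ F b].

Definition extreme_point (c : Sof) : Prop :=
  forall lambda a b, 0 < lambda < 1 -> is_convex_comb lambda a b c ->
  a = c /\ b = c.

End SoficRepresentations.

Arguments soficRep R omega {omegaU} G.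
Arguments Sof R omega {omegaU} G.

(* Main.v *)
(* Call a representation a summand of another one if some amplification of it
   embeds almost equivariantly, with positive density, into an amplification of
   the other; on classes this says that it has a positive coefficient in a convex
   decomposition. Almost invariant subsets of a direct sum meet the two terms in
   almost invariant subsets, so a summand of a direct sum shares a summand with
   one of the terms. Hence, for a set S of extreme points, the classes all of
   whose summands have a summand in S form a face: it is hereditary because
   summands are transitive, convex by the preceding remark, and it contains S
   because a summand of an extreme point is equivalent to it. Let F_j be this
   face for S = {Theta_i : i >= j}. A class in every F_j has some Theta_i as a
   summand; since it lies in F_(i+1), Theta_i has a summand Theta_i' with i' > i,
   whence [Theta_i'] = [Theta_i] by extremality, a contradiction. *)

From HB Require Import structures.
Require Import Defs.
From mathcomp Require Import all_boot all_order all_algebra.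
From mathcomp Require Import boolp classical_sets functions cardinality reals.
From mathcomp Require Import filter topology normedtype sequences.
From mathcomp Require Import perm mxtens zify lra.

Set Implicit Arguments.
Unset Strict Implicit.
Unset Printing Implicit Defensive.

Import Order.TTheory GRing.Theory Num.Theory.
Import numFieldNormedType.Exports.

Local Open Scope classical_set_scope.

(** * Extending partial permutations of finite sets *)

Lemma card_preim_inj (A B : finType) (f : A -> B) (S : {set B}) :
  injective f -> #|[set x | f x \in S]%SET| <= #|S|.
Proof.
move=> fi; rewrite -(card_imset _ fi); apply: subset_leq_card.
by apply/fintype.subsetP => _ /imsetP[x + ->]; rewrite inE.
Qed.

(** Among all permutations [q], take one agreeing with the partial map induced by [p] at the largest
    number of points. If it failed anywhere, a transposition would gain one more point. *)
Lemma perm_extend (e d : nat) (h : 'I_e -> 'I_d) (p : 'S_d) : injective h ->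
  exists q : 'S_e, forall x y, p (h x) = h y -> q x = y.
Proof.
move=> hi; pose good (q : 'S_e) := [set x | p (h x) == h (q x)]%SET.
case: (@arg_maxnP _ (1%g : {perm _}) xpredT (fun q => #|good q|)) => // q _ qmax.
exists q => x y pxy; apply/eqP; apply: contraT => qxy.
(* The transposition corrects the value at [x]. A good point [z] has [q z] different from both [q x]
   and [y], so it stays good. *)
have : #|good (q * tperm (q x) y)%g| <= #|good q| by exact: qmax.
rewrite leqNgt => /negP; case.
apply: proper_card; apply/properP; split; last first.
  by exists x; rewrite !inE ?permM ?tpermL ?pxy// (inj_eq hi) eq_sym.
apply/fintype.subsetP => z; rewrite !inE permM => /eqP pz.
rewrite tpermD ?pz//.
  apply: contraNneq qxy => /perm_inj xz; apply/eqP/hi.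
  by rewrite -pxy xz pz.
apply: contraNneq qxy => yz; have : p (h x) = p (h z) by rewrite pxy pz yz.
by move=> /perm_inj/hi ->; rewrite yz.
Qed.

(** * Properties that hold outside a negligible proportion of points *)

Section AlmostEverywhere.
Context (omega : set_system nat) {omegaU : UltraFilter omega}.

(* [P] holds on 'I_(d k) outside a proportion tending to 0 along [omega]; the
   arithmetic form avoids real limits. *)
Definition ae (d : nat -> nat) (P : forall k, 'I_(d k) -> Prop) : Prop :=
  forall M, \forall k \near omega, M * #|[set x | ~~ `[< P k x >]]%SET| <= d k.

Lemma ae_near d (P : forall k, 'I_(d k) -> Prop) :
  (\forall k \near omega, forall x, P k x) -> ae P.
Proof.
move=> h M; apply: filterS h => k Pk.
rewrite (_ : [set x | _]%SET = finset.set0) ?cards0 ?muln0//.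
by apply/setP => x; rewrite !inE; apply/negbF/asboolP.
Qed.

Lemma ae_all d (P : forall k, 'I_(d k) -> Prop) : (forall k x, P k x) -> ae P.
Proof. by move=> h; apply: ae_near; apply: nearW. Qed.

Lemma ae_and d (P Q : forall k, 'I_(d k) -> Prop) :
  ae P -> ae Q -> ae (fun k x => P k x /\ Q k x).
Proof.
move=> hP hQ M; apply: filterS2 (hP (2 * M)) (hQ (2 * M)) => k.
set A := #|_|; set B := #|_|; set C := #|_| => hA hB.
suff : C <= A + B by nia.
rewrite /A /B /C; apply: leq_trans (leq_card_setU _ _).
apply: subset_leq_card; apply/fintype.subsetP => x; rewrite !inE -negb_and.
by apply: contraNN => /andP[/asboolP ? /asboolP ?]; apply/asboolP.
Qed.

Lemma ae_sub d (P Q : forall k, 'I_(d k) -> Prop) :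
  ae P -> (forall k x, P k x -> Q k x) -> ae Q.
Proof.
move=> hP PQ M; apply: filterS (hP M) => k; apply: leq_trans.
rewrite leq_mul2l; apply/orP; right; apply: subset_leq_card.
apply/fintype.subsetP => x; rewrite !inE; apply: contraNN => /asboolP ?.
by apply/asboolP; apply: PQ.
Qed.

(** For injections of ['I_(d k)] into ['I_(e k)], this says that the images have density bounded
    below along [omega]. *)
Definition dominates (d e : nat -> nat) :=
  exists C, \forall k \near omega, e k <= C * d k.

Lemma dominates_trans d e f : dominates d e -> dominates e f -> dominates d f.
Proof.
move=> [C hC] [D hD]; exists (D * C); apply: filterS2 hC hD => k; nia.
Qed.

Lemma dominatesW d e : (forall k, e k <= d k) -> dominates d e.
Proof. by move=> h; exists 1; apply: nearW => k; rewrite mul1n. Qed.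

(** An exceptional set pulls back along an injection to at most as many points, and domination keeps
    these negligible relative to the smaller set. *)
Lemma ae_inj d e (P : forall k, 'I_(d k) -> Prop) (Q : forall k, 'I_(e k) -> Prop)
    (u : forall k, 'I_(e k) -> 'I_(d k)) :
  dominates e d -> (forall k, injective (u k)) -> ae P ->
  (forall k x, P k (u k x) -> Q k x) -> ae Q.
Proof.
(* The factor is cancelled below, so [C.+1] replaces [C], which may be 0. *)
move=> [C hC] ui hP PQ M; apply: filterS2 hC (hP (C.+1 * M)) => k.
set A := #|_|; set B := #|_| => hd hA.
suff BA : B <= A.
  rewrite -(leq_pmul2l (ltn0Sn C)) mulnA; apply: leq_trans (_ : C * e k <= _).
    by apply: leq_trans hd; apply: leq_trans hA; rewrite leq_mul2l BA orbT.
  by rewrite leq_mul2r leqnSn orbT.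
rewrite /A /B; apply: leq_trans (card_preim_inj _ (ui k)).
apply: subset_leq_card; apply/fintype.subsetP => x; rewrite !inE.
by apply: contraNN => /asboolP ?; apply/asboolP; apply: PQ.
Qed.

Lemma ae_comp d e (P : forall k, 'I_(d k) -> Prop) (u : forall k, 'I_(e k) -> 'I_(d k)) :
  dominates e d -> (forall k, injective (u k)) -> ae P ->
  ae (fun k x => P k (u k x)).
Proof. by move=> de ui hP; exact: ae_inj de ui hP _. Qed.

(** Each exceptional point is repeated [r k] times, so the proportion is unchanged. *)
Lemma ae_tens (d r : nat -> nat) (P : forall k, 'I_(d k) -> Prop) :
  ae P -> ae (fun k (x : 'I_(d k * r k)) => P k (mxtens_unindex x).1).
Proof.
move=> hP M; apply: filterS (hP M) => k.
set A := #|_|; set B := #|_| => hA.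
suff -> : B = A * r k by rewrite mulnA leq_mul2r hA orbT.
have ci := can_inj (@mxtens_indexK (d k) (r k)).
rewrite /A /B -[r k in RHS]card_ord -cardsT -cardsX -(card_imset _ ci).
apply: eq_card => x; case: (mxtens_indexP x) => i j.
by rewrite mem_imset// !inE mxtens_indexK andbT.
Qed.

Lemma ae_sum (d e : nat -> nat) (P : forall k, 'I_(d k + e k) -> Prop) :
  ae (fun k x => P k (lshift (e k) x)) -> ae (fun k x => P k (rshift (d k) x)) ->
  ae P.
Proof.
move=> hl hr M; apply: filterS2 (hl M) (hr M) => k.
set A := #|_|; set B := #|_|; set C := #|_| => hA hB.
suff : C <= A + B by nia.
have := card_imset _ (@lshift_inj (d k) (e k)); have := card_imset _ (@rshift_inj (d k) (e k)).
rewrite /A /B => <- <-.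
apply: leq_trans (leq_card_setU _ _); apply: subset_leq_card.
apply/fintype.subsetP => x; rewrite !inE; case: (split_ordP x) => y -> h.
  by rewrite mem_imset ?inE ?h//; apply: lshift_inj.
by rewrite orbC mem_imset ?inE ?h//; apply: rshift_inj.
Qed.

Context {R : realType}.

Lemma ae_cvg (d : nat -> nat) (P : forall k, 'I_(d k) -> Prop) :
  (forall k, 0 < d k) ->
  ae P <-> (fun k => (d k)%:R^-1 * #|[set x | ~~ `[< P k x >]]%SET|%:R)%R @ omega --> (0 : R)%R.
Proof.
move=> d0; split=> [hP|/cvgr0Pnorm_le h M].
  apply/cvgr0Pnorm_le => e e0.
  (* By the Archimedean property, a proportion at most [1 / M] is at most [e]. *)
  have [M hM] : exists M : nat, (e^-1 <= M%:R)%R.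
    by exists (Num.bound e^-1); apply/ltW/archi_boundP; rewrite invr_ge0 ltW.
  apply: filterS (hP M) => k; rewrite -(ler_nat R) natrM => hk.
  rewrite ger0_norm ?mulr_ge0 ?invr_ge0// ler_pdivrMl ?ltr0n//.
  rewrite -ler_pdivrMr// mulrC; apply: le_trans hk.
  by rewrite ler_wpM2r.
have M0 : (0 < M.+1%:R^-1 :> R)%R by rewrite invr_gt0 ltr0n.
apply: filterS (h _ M0) => k.
rewrite ger0_norm ?mulr_ge0 ?invr_ge0// ler_pdivrMl ?ltr0n//.
rewrite ler_pdivlMr ?ltr0n// -natrM ler_nat mulnC; apply: leq_trans.
by rewrite leq_mul2r leqnSn orbT.
Qed.

(** The Hamming distance is the proportion of points where two permutations differ, and the trace in
    [utrace_ae] is the proportion of fixed points. These two lemmas remove the reals from most of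
    what follows. *)
Lemma ueq_ae (n : dimseq) (p q : permseq n) :
  upi R p = upi R q :> uprod R omega n <-> ae (fun k x => p k x = q k x).
Proof.
rewrite (ae_cvg _ (dim_gt0 n)).
rewrite (rwP (@upiP R omega _ n p q)) -(rwP (asboolP _)).
under eq_fun do rewrite hammingE ?dim_gt0//.
suff -> : (fun k => (n k)%:R^-1 * #|[set i | p k i != q k i]%SET|%:R)%R =
  (fun k => (n k)%:R^-1 * #|[set i | ~~ `[<p k i = q k i>]]%SET|%:R)%R :> (nat -> R) by [].
apply/funext => k; congr (_ * _%:R)%R; apply: eq_card => i; rewrite !inE.
by congr (~~ _); apply/eqP/asboolP.
Qed.

Lemma utrace_ae (n : dimseq) (p : permseq n) :
  utrace (upi R p : uprod R omega n) = 0%R <-> ae (fun k x => p k x <> x).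
Proof.
rewrite (ae_cvg _ (dim_gt0 n)).
have -> : (fun k => (n k)%:R^-1 * #|[set i | ~~ `[<p k i <> i>]]%SET|%:R)%R =
  (fun k => ntrace (perm_mx (p k))) :> (nat -> R).
  apply/funext => k; rewrite /ntrace mxtrace_perm.
  congr (_ * _%:R)%R; apply: eq_card => i; rewrite !inE.
  by rewrite asbool_neg negbK; apply/asboolP/eqP.
by split=> [<-|]; [exact: utrace_upi | exact: utraceE].
Qed.

End AlmostEverywhere.

(** * Sofic representations as almost actions, and embeddings between them *)

Section Embeddings.
Context (R : realType) (omega : set_system nat) {omegaU : UltraFilter omega}.
Context (G : groupType).
Implicit Types (Theta Psi Phi : soficRep R omega G) (r t : multseq).

Local Notation ae := (ae omega).
Local Notation dominates := (dominates omega).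

(** A chosen lift of [Theta g], so the group laws hold only almost everywhere. Permutations compose
    from left to right, whence the order of [g] and [h] in [actM]. *)
Definition act Theta (g : G) : permseq (sdim Theta) := repr (Theta g).

Lemma act_ae Theta g (p : permseq (sdim Theta)) :
  Theta g = upi R p <-> ae (fun k x => act Theta g k x = p k x).
Proof. by rewrite -(ueq_ae (R := R)) upi_repr. Qed.

Lemma actM Theta g h :
  ae (fun k x => act Theta (g * h)%g k x = act Theta h k (act Theta g k x)).
Proof.
have /act_ae : Theta (g * h)%g = upi R (fun k => act Theta g k * act Theta h k)%g.
  by rewrite gmulfM upiM !upi_repr.
by move/ae_sub; apply => k x; rewrite permM.
Qed.

Lemma act_free Theta g : g != 1%g -> ae (fun k x => act Theta g k x <> x).
Proof. by move=> g1; apply/(utrace_ae (R := R)); rewrite upi_repr srep_trace. Qed.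

Lemma act_amp Theta r g :
  ae (fun k x => act (amp Theta r) g k x = tens_perm (r k) (act Theta g k) x).
Proof. exact/act_ae. Qed.

Lemma act_dsum Theta Psi g : ae (fun k x =>
  act (dsum Theta Psi) g k x = sum_perm (act Theta g k) (act Psi g k) x).
Proof. exact/act_ae. Qed.

Section OfPermutations.
Context (n : dimseq) (rho : G -> permseq n).
Hypothesis rhoM : forall g h,
  ae (fun k x => rho (g * h)%g k x = rho h k (rho g k x)).
Hypothesis rho_free : forall g, g != 1%g -> ae (fun k x => rho g k x <> x).

Let rep_fun (g : G) : uprod R omega n := upi R (rho g).

Let rep_funM : {morph rep_fun : g h / (g * h)%g}.
Proof.
move=> g h; rewrite /rep_fun -upiM; apply/ueq_ae.
by apply: ae_sub (rhoM g h) _ => k x; rewrite permM.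
Qed.

HB.instance Definition _ := isMultiplicative.Build _ _ rep_fun rep_funM.

Let rep_trace g : g != 1%g -> utrace (rep_fun g) = 0%R.
Proof. by move=> g1; apply/utrace_ae; exact: rho_free. Qed.

(** Converse to [actM] and [act_free]: these two almost everywhere conditions suffice to build a
    sofic representation. *)
Definition rep_of_perms : soficRep R omega G := @SoficRep _ _ _ _ n rep_fun rep_trace.

Lemma act_rep_of_perms g : ae (fun k x => act rep_of_perms g k x = rho g k x).
Proof. exact/act_ae. Qed.

End OfPermutations.

(** Exceptional points are counted relative to the dimension of [Theta]. Positive density of the
    image is a separate condition, [dominates]. *)
Definition emb Theta Phi (f : forall k, 'I_(sdim Theta k) -> 'I_(sdim Phi k)) :=
  (forall k, injective (f k)) /\
  forall g, ae (fun k x => f k (act Theta g k x) = act Phi g k (f k x)).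

(** Lets equivariance be checked on explicit permutations instead of the chosen lifts. Domination
    makes the exceptional set in [Phi] negligible after pulling back along [f]. *)
Lemma emb_of Theta Phi (f : forall k, 'I_(sdim Theta k) -> 'I_(sdim Phi k))
    (theta : G -> permseq (sdim Theta)) (phi : G -> permseq (sdim Phi)) :
  dominates (sdim Theta) (sdim Phi) -> (forall k, injective (f k)) ->
  (forall g, ae (fun k x => act Theta g k x = theta g k x)) ->
  (forall g, ae (fun k x => act Phi g k x = phi g k x)) ->
  (forall g, ae (fun k x => f k (theta g k x) = phi g k (f k x))) ->
  emb f.
Proof.
move=> dom fi hT hP hf; split=> // g.
apply: ae_sub (ae_and (hT g) (ae_and (ae_comp dom fi (hP g)) (hf g))) _.
by move=> k x [-> [-> ->]].
Qed.

Lemma emb_comp Theta Phi Psi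
    (f : forall k, 'I_(sdim Theta k) -> 'I_(sdim Phi k))
    (h : forall k, 'I_(sdim Phi k) -> 'I_(sdim Psi k)) :
  dominates (sdim Theta) (sdim Phi) -> emb f -> emb h ->
  @emb Theta Psi (fun k x => h k (f k x)).
Proof.
move=> dom [fi hf] [hi hh]; split=> [k x y /hi/fi|g]//.
apply: ae_sub (ae_and (hf g) (ae_comp dom fi (hh g))) _.
by move=> k x [-> ->].
Qed.

Lemma emb_amp Theta Phi r (f : forall k, 'I_(sdim Theta k) -> 'I_(sdim Phi k)) :
  dominates (sdim Theta) (sdim Phi) -> emb f ->
  @emb (amp Theta r) (amp Phi r)
    (fun k x => mxtens_index (f k (mxtens_unindex x).1, (mxtens_unindex x).2)).
Proof.
move=> [C dom] [fi hf]; apply: emb_of (act_amp Theta r) (act_amp Phi r) _.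
- by exists C; apply: filterS dom => k /= h; rewrite mulnA leq_mul2r h orbT.
- move=> k x y; case: (mxtens_indexP x) => i j; case: (mxtens_indexP y) => i' j'.
  by rewrite !mxtens_indexK /= => /(can_inj (@mxtens_indexK _ _)) [/fi -> ->].
- move=> g; apply: ae_sub (ae_tens r (hf g)) _ => k x.
  case: (mxtens_indexP x) => i j; rewrite mxtens_indexK => hi.
  by rewrite !tens_permE !mxtens_indexK; move: hi => /= ->.
Qed.

Lemma conjugate_ae Theta Phi (e : forall k, sdim Theta k = sdim Phi k)
    (w : permseq (sdim Phi)) g :
  ucast e (Theta g) = (Phi g ^ upi R w)%g <->
  ae (fun k x => cast_ord (e k) (act Theta g k x) =
    w k (act Phi g k ((w k)^-1%g (cast_ord (e k) x)))).
Proof.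
have -> : (Phi g ^ upi R w)%g = upi R (fun k => (w k)^-1 * (act Phi g k * w k))%g.
  rewrite (upiM R (fun k => (w k)^-1)%g (fun k => act Phi g k * w k)%g) upiV.
  by rewrite (upiM R (act Phi g) w) upi_repr conjgE.
rewrite -[Theta g]upi_repr ucastE ueq_ae.
have dom1 : dominates (sdim Theta) (sdim Phi) by apply: dominatesW => k; rewrite e.
have dom2 : dominates (sdim Phi) (sdim Theta) by apply: dominatesW => k; rewrite e.
have ci1 k := @cast_ord_inj _ _ (e k); have ci2 k := @cast_ord_inj _ _ (esym (e k)).
split=> h.
  apply: (ae_inj dom1 ci1 h) => k x.
  by rewrite cast_permE !permM cast_ordK.
apply: (ae_inj dom2 ci2 h) => k x.
by rewrite cast_permE !permM cast_ordKV.
Qed.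

Lemma conjugate_emb Theta Phi : conjugate_reps Theta Phi ->
  (forall k, sdim Theta k = sdim Phi k) /\
  exists f : forall k, 'I_(sdim Theta k) -> 'I_(sdim Phi k), emb f.
Proof.
move=> [e [u h]]; split=> //.
exists (fun k x => (repr u k)^-1%g (cast_ord (e k) x)); split.
  by move=> k x y /perm_inj/cast_ord_inj.
move=> g; move: (h g); rewrite -{1}[u]upi_repr => /conjugate_ae.
by move/ae_sub; apply => k x ->; rewrite permK.
Qed.

(** In equal dimensions the injections are bijections, and their inverses are the conjugating
    permutations. *)
Lemma emb_conjugate Theta Phi (e : forall k, sdim Theta k = sdim Phi k)
    (f : forall k, 'I_(sdim Theta k) -> 'I_(sdim Phi k)) :
  emb f -> conjugate_reps Theta Phi.
Proof.
move=> [fi hf].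
have wi k : injective (fun x => f k (cast_ord (esym (e k)) x)).
  by move=> x y /fi/cast_ord_inj.
pose w k := (perm (@wi k))^-1%g; exists e, (upi R w) => g; apply/conjugate_ae.
apply: ae_sub (hf g) _ => k x hx; apply: (@perm_inj _ (perm (@wi k))).
by rewrite /w permKV invgK !permE !cast_ordK.
Qed.

End Embeddings.

(** * Summands: embeddings of positive density up to amplification *)

Section Summands.
Context (R : realType) (omega : set_system nat) {omegaU : UltraFilter omega}.
Context (G : groupType).
Implicit Types (Theta Psi Phi : soficRep R omega G) (r t : multseq).

Local Notation ae := (ae omega).
Local Notation dominates := (dominates omega).

Definition embeds Theta Phi := dominates (sdim Theta) (sdim Phi) /\
  exists f : forall k, 'I_(sdim Theta k) -> 'I_(sdim Phi k), emb f.

Lemma embeds_trans Theta Phi Psi :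
  embeds Theta Phi -> embeds Phi Psi -> embeds Theta Psi.
Proof.
move=> [d [f hf]] [d' [h hh]]; split; first exact: dominates_trans d d'.
by eexists; exact: (emb_comp d hf hh).
Qed.

Lemma conjugate_embeds Theta Phi : conjugate_reps Theta Phi -> embeds Theta Phi.
Proof.
move=> /conjugate_emb[e hf]; split=> //.
by apply: dominatesW => k; rewrite e.
Qed.

Lemma embeds_amp Theta Phi r :
  embeds Theta Phi -> embeds (amp Theta r) (amp Phi r).
Proof.
move=> [d [f hf]]; split; last by eexists; exact: (emb_amp _ d hf).
case: d => C d; exists C; apply: filterS d => k /= h.
by rewrite mulnA leq_mul2r h orbT.
Qed.

Lemma embeds_ampAC Theta r t :
  embeds (amp (amp Theta r) t) (amp (amp Theta t) r).
Proof.
apply/conjugate_embeds/(conjugate_trans (conjugate_ampA _ _ _)).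
apply: conjugate_trans (conjugate_sym (conjugate_ampA _ _ _)).
exact: conjugate_ampC.
Qed.

(* Equivalently, the class of [Theta] has a positive coefficient in some convex
   decomposition of the class of [Phi] (summand_convex_comb, convex_comb_summand). *)
Definition summand Theta Phi := exists r t, embeds (amp Theta r) (amp Phi t).

Lemma embeds_summand Theta Phi : embeds Theta Phi -> summand Theta Phi.
Proof. by move=> h; exists mult_one, mult_one; exact: embeds_amp. Qed.

(** Amplifying the first embedding by [r'] and the second by [t] makes them meet in the
    amplification of [Phi] by both. *)
Lemma summand_trans Theta Phi Psi :
  summand Theta Phi -> summand Phi Psi -> summand Theta Psi.
Proof.
move=> [r [t h]] [r' [t' h']]; exists (mult_mul r r'), (mult_mul t' t).
apply: embeds_trans (conjugate_embeds (conjugate_ampA _ _ _)).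
apply: embeds_trans (embeds_amp t h').
apply: embeds_trans (embeds_ampAC _ _ _).
apply: embeds_trans (embeds_amp r' h).
exact/conjugate_embeds/conjugate_sym/conjugate_ampA.
Qed.

Lemma sclass_summand Theta Phi : sclass Theta = sclass Phi -> summand Theta Phi.
Proof.
by move=> /sclassP[r [t h]]; exists r, t; exact: conjugate_embeds.
Qed.

Lemma sclass_amp Theta r : sclass (amp Theta r) = sclass Theta.
Proof.
by apply/sclassP; exists mult_one, (mult_mul r mult_one); exact: conjugate_ampA.
Qed.

Lemma emb_lshift Theta Psi : dominates (sdim Theta) (sdim (dsum Theta Psi)) ->
  @emb _ _ _ _ Theta (dsum Theta Psi) (fun k x => lshift (sdim Psi k) x).
Proof.
move=> dom; apply: (emb_of dom _ _ (act_dsum Theta Psi)) => [k|g|g].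
- exact: lshift_inj.
- exact: ae_all.
- by apply: ae_all => k x; rewrite sum_perml.
Qed.

Lemma emb_rshift Theta Psi : dominates (sdim Psi) (sdim (dsum Theta Psi)) ->
  @emb _ _ _ _ Psi (dsum Theta Psi) (fun k x => rshift (sdim Theta k) x).
Proof.
move=> dom; apply: (emb_of dom _ _ (act_dsum Theta Psi)) => [k|g|g].
- exact: rshift_inj.
- exact: ae_all.
- by apply: ae_all => k x; rewrite sum_permr.
Qed.

(** The pair (i, j) has index i * r + j, so on both sides all points of the first term precede those
    of the second, and the identity on indices is equivariant. *)
Lemma amp_dsum Theta Psi r :
  embeds (amp (dsum Theta Psi) r) (dsum (amp Theta r) (amp Psi r)).
Proof.
have e k : ((sdim Theta k + sdim Psi k) * r k =
  sdim Theta k * r k + sdim Psi k * r k)%N by rewrite mulnDl.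
have dom : dominates (sdim (amp (dsum Theta Psi) r)) (sdim (dsum (amp Theta r) (amp Psi r))).
  by apply: dominatesW => k /=; rewrite e.
split=> //; exists (fun k x => cast_ord (e k) x).
have lE k i j : cast_ord (e k) (mxtens_index (lshift (sdim Psi k) i, j)) =
    lshift _ (mxtens_index (i, j)) by exact: val_inj.
have rE k i j : cast_ord (e k) (mxtens_index (rshift (sdim Theta k) i, j)) =
    rshift _ (mxtens_index (i, j)) by apply: val_inj; rewrite /= mulnDl addnA.
pose theta g : permseq (sdim (amp (dsum Theta Psi) r)) :=
  fun k => tens_perm (r k) (sum_perm (act Theta g k) (act Psi g k)).
pose phi g : permseq (sdim (dsum (amp Theta r) (amp Psi r))) :=
  fun k => sum_perm (tens_perm (r k) (act Theta g k)) (tens_perm (r k) (act Psi g k)).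
apply: (@emb_of _ _ _ _ _ _ _ theta phi) => //.
- move=> g; apply: ae_sub (ae_and (act_amp (dsum Theta Psi) r g)
    (ae_tens r (act_dsum Theta Psi g))) _.
  move=> k x [-> ]; case: (mxtens_indexP x) => i j; rewrite mxtens_indexK => h.
  by rewrite !tens_permE; congr (mxtens_index (_, _)).
- move=> g; apply: ae_sub (ae_and (act_dsum (amp Theta r) (amp Psi r) g) _) _; last first.
    by move=> k x [-> h]; exact: h.
  apply: ae_sum.
    apply: ae_sub (act_amp Theta r g) _ => k x h.
    by rewrite !sum_perml; congr lshift.
  apply: ae_sub (act_amp Psi r g) _ => k x h.
  by rewrite !sum_permr; congr rshift.
- move=> g; apply: ae_all => k x; case: (mxtens_indexP x) => i j.
  case: (split_ordP i) => {}i ->; rewrite !tens_permE.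
    by rewrite sum_perml !lE sum_perml tens_permE.
  by rewrite sum_permr !rE sum_permr tens_permE.
Qed.

Definition join n m p (f : 'I_n -> 'I_p) (h : 'I_m -> 'I_p) (x : 'I_(n + m)) :=
  match fintype.split x with inl i => f i | inr j => h j end.

Lemma join_lshift n m p (f : 'I_n -> 'I_p) (h : 'I_m -> 'I_p) i :
  join f h (lshift m i) = f i.
Proof. by rewrite /join (unsplitK (inl i)). Qed.

Lemma join_rshift n m p (f : 'I_n -> 'I_p) (h : 'I_m -> 'I_p) j :
  join f h (rshift n j) = h j.
Proof. by rewrite /join (unsplitK (inr j)). Qed.

Lemma emb_join Theta Psi Phi
    (f : forall k, 'I_(sdim Theta k) -> 'I_(sdim Phi k))
    (h : forall k, 'I_(sdim Psi k) -> 'I_(sdim Phi k)) :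
  dominates (sdim (dsum Theta Psi)) (sdim Phi) ->
  emb f -> emb h -> (forall k x y, f k x <> h k y) ->
  @emb _ _ _ _ (dsum Theta Psi) Phi (fun k => join (f k) (h k)).
Proof.
move=> dom [fi hf] [hi hh] fh.
apply: (emb_of dom _ (act_dsum Theta Psi)) => [k x y|g|g].
- case: (split_ordP x) => {}x ->; case: (split_ordP y) => {}y ->;
    rewrite ?join_lshift ?join_rshift.
  + by move/fi ->.
  + by move/fh.
  + by move/esym/fh.
  + by move/hi ->.
- exact: ae_all.
- apply: ae_sum.
    by apply: ae_sub (hf g) _ => k x; rewrite sum_perml !join_lshift.
  by apply: ae_sub (hh g) _ => k x; rewrite sum_permr !join_rshift.
Qed.

(* A partial permutation of the almost invariant set [codom h] extends to a
   permutation, which costs only a negligible set of points. *)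
Lemma cut_down Theta (e : dimseq) (h : forall k, 'I_(e k) -> 'I_(sdim Theta k)) :
  dominates e (sdim Theta) -> (forall k, injective (h k)) ->
  (forall g, ae (fun k x => exists y, act Theta g k (h k x) = h k y)) ->
  exists rho rhoM rho_free, @emb _ _ _ _ (@rep_of_perms R omega _ G e rho rhoM rho_free) Theta h.
Proof.
move=> dom hi inv.
have [rho rhoE] : exists rho : G -> permseq e, forall g k x y,
    act Theta g k (h k x) = h k y -> rho g k x = y.
  exists (fun g k => sval (cid (perm_extend (act Theta g k) (hi k)))) => g k.
  by case: cid.
have hrho g : ae (fun k x => h k (rho g k x) = act Theta g k (h k x)).
  by apply: ae_sub (inv g) _ => k x [y hy]; rewrite (rhoE _ _ _ _ hy).
have ed : dominates e e by exact: dominatesW.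
have rhoM a b : ae (fun k x => rho (a * b)%g k x = rho b k (rho a k x)).
  (* The relation for [b] is required at [rho a k x], so its exceptional set is pulled back along a
     permutation. *)
  have hb : ae (fun k x => h k (rho b k (rho a k x)) = act Theta b k (h k (rho a k x))).
    exact: ae_comp ed (fun k => @perm_inj _ (rho a k)) (hrho b).
  apply: ae_sub (ae_and (hrho (a * b)%g) (ae_and (hrho a) (ae_and hb
    (ae_comp dom hi (actM Theta a b))))) _ => k x [h1 [h2 [h3 h4]]].
  by apply: (hi k); rewrite h1 h3 h2 h4.
have rho_free a : a != 1%g -> ae (fun k x => rho a k x <> x).
  move=> a1; apply: ae_sub (ae_and (hrho a) (ae_comp dom hi (act_free Theta a1))) _.
  by move=> k x [h1 h2] h3; apply: h2; rewrite -h1 h3.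
exists rho, rhoM, rho_free; split=> // g.
have hE : ae (fun k x => act (rep_of_perms R rhoM rho_free) g k x = rho g k x).
  exact: act_rep_of_perms.
by apply: (ae_sub (ae_and hE (hrho g))) => k x [-> ->].
Qed.

End Summands.

(** * Complements and fibre products of injections between finite sets *)

Lemma complement_inj n m (f : 'I_n -> 'I_m) : injective f ->
  exists h : 'I_(m - n) -> 'I_m, [/\ injective h, forall x y, f x <> h y
    & forall z, (exists x, z = f x) \/ (exists y, z = h y)].
Proof.
move=> fi; pose A := (~: (f @: [set: 'I_n]))%SET.
have cA : #|A| = m - n.
  by have := cardsC (f @: [set: 'I_n])%SET; rewrite card_imset// cardsT !card_ord -/A;
    move/(congr1 (subn^~ n)); rewrite addKn.
exists (fun y => enum_val (cast_ord (esym cA) y)); split.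
- by move=> x y /enum_val_inj/cast_ord_inj.
- move=> x y xy; have := enum_valP (cast_ord (esym cA) y); rewrite -xy inE.
  by rewrite imset_f.
move=> z; have [/imsetP[x _ ->]|zA] := boolP (z \in f @: [set: 'I_n])%SET.
  by left; exists x.
have {}zA : z \in A by rewrite inE.
by right; exists (cast_ord cA (enum_rank_in zA z)); rewrite cast_ordK enum_rankK_in.
Qed.

Lemma card_preim_codom (A B C : finType) (f : A -> C) (i : B -> C) : injective f ->
  #|[set x | f x \in codom i]%SET| <= #|B|.
Proof.
move=> fi; rewrite -(card_imset _ fi) -cardsT.
apply: leq_trans (leq_imset_card i _); apply: subset_leq_card.
apply/fintype.subsetP => _ /imsetP[x + ->]; rewrite inE => /codomP[y ->].
exact: imset_f.
Qed.

(* The fibre product of [f] and [i] if it contains at least half of 'I_d, and a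
   junk pair of injections of large domain otherwise. *)
Lemma fibre_product d n m (f : 'I_d -> 'I_m) (i : 'I_n -> 'I_m) :
  injective f -> injective i ->
  exists (e : nat) (h : 'I_e -> 'I_d) (j : 'I_e -> 'I_n),
    [/\ injective h, injective j, minn d n <= 2 * e
      & d <= 2 * #|[set x | f x \in codom i]%SET| ->
        [/\ d <= 2 * e, forall x, f (h x) = i (j x)
          & forall y z, f y = i z -> exists x, y = h x]].
Proof.
move=> fi ii; set A := [set x | _]%SET; have [dA|dA] := leqP d (2 * #|A|).
  have /fin_all_exists[j hj] (x : 'I_(#|A|)) : exists z, f (enum_val x) = i z.
    by apply/codomP; have := enum_valP x; rewrite inE.
  exists #|A|, enum_val, j; split=> [|x y||_].
  - exact: enum_val_inj.
  - by move=> xy; apply/enum_val_inj/fi; rewrite !hj xy.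
  - by rewrite geq_min dA.
  split=> // y z yz; have yA : y \in A by rewrite inE yz codom_f.
  by exists (enum_rank_in yA y); rewrite enum_rankK_in.
(* The junk pair still satisfies [minn d n <= 2 * e], which keeps the dimensions positive at every
   index and tending to infinity. *)
exists (minn d n), (widen_ord (geq_minl d n)), (widen_ord (geq_minr d n)).
split=> [x y /(congr1 val)/= xy|x y /(congr1 val)/= xy||].
- exact: val_inj.
- exact: val_inj.
- lia.
- by [].
Qed.

(** * Complements of summands, summands of direct sums, and the resulting faces *)

Section Riesz.
Context (R : realType) (omega : set_system nat) {omegaU : UltraFilter omega}.
Context (G : groupType).
Implicit Types (Theta Psi Phi Delta : soficRep R omega G) (r t : multseq).

Local Notation ae := (ae omega).
Local Notation dominates := (dominates omega).

(** Compactness of the interval gives a cluster point, and an ultrafilter converges to its cluster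
    points. *)
Lemma ultrafilter_cvg (a : nat -> R) : (forall k, 0 <= a k <= 1)%R ->
  exists l : R, a @ omega --> l.
Proof.
move=> a01; have [l [_ cl]] : (`[0%R, 1%R]%classic `&` cluster (fmap a omega) : set R) !=set0.
  by apply: segment_compact; apply: nearW => k /=; rewrite in_itv /= a01.
exists l => B lB; have [//|nB] := in_ultra_setVsetC (a @^-1` B) omegaU.
by have [x []] := cl (~` B) B nB lB.
Qed.

(** The new exceptional set lies in the image of the old one, inside a set that is at least as
    large. *)
Lemma ae_push (d e : nat -> nat) (f : forall k, 'I_(d k) -> 'I_(e k))
    (P : forall k, 'I_(d k) -> Prop) :
  (forall k, injective (f k)) -> ae P ->
  ae (fun k z => forall y, z = f k y -> P k y).
Proof.
move=> fi hP M; apply: filterS (hP M) => k.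
set A := #|_|; set B := #|_| => hA.
have de : d k <= e k by have := leq_card _ (fi k); rewrite !card_ord.
suff BA : B <= A by apply: leq_trans de; apply: leq_trans hA; rewrite leq_mul2l BA orbT.
apply: leq_trans (leq_imset_card (f k) _); apply: subset_leq_card.
apply/fintype.subsetP => z; rewrite inE => /asboolPn/existsNP[y /not_implyP[-> nP]].
by apply: imset_f; rewrite inE; apply/asboolPn.
Qed.

Lemma act1 Theta : ae (fun k x => act Theta 1%g k x = x).
Proof.
apply: ae_sub (actM Theta 1%g 1%g) _ => k x; rewrite mulg1.
by move/perm_inj/esym.
Qed.

Lemma actVK Theta g : ae (fun k x => act Theta g^-1%g k (act Theta g k x) = x).
Proof.
apply: ae_sub (ae_and (actM Theta g g^-1%g) (act1 Theta)) _ => k x.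
by rewrite mulgV => -[<- ->].
Qed.

Lemma conjugate_amp1 Theta : conjugate_reps (amp Theta mult_one) Theta.
Proof.
have e k : sdim (amp Theta mult_one) k = sdim Theta k by rewrite /= muln1.
have dom : dominates (sdim (amp Theta mult_one)) (sdim Theta).
  by apply: dominatesW => k; rewrite e.
pose f k (x : 'I_(sdim (amp Theta mult_one) k)) := (mxtens_unindex x).1.
apply: (emb_conjugate e (f := f)).
apply: (emb_of dom _ (act_amp Theta mult_one)) => [k x y|g|g].
- rewrite /f; case: (mxtens_indexP x) => i j; case: (mxtens_indexP y) => i' j'.
  by rewrite !mxtens_indexK (ord1 j) (ord1 j') => /= ->.
- exact: ae_all.
- apply: ae_all => k x; rewrite /f; case: (mxtens_indexP x) => i j.
  by rewrite tens_permE !mxtens_indexK.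
Qed.

(** The complement of an almost invariant image is almost invariant, so it carries a representation.
    The factor 2 makes its dimension at least that of [Theta], hence positive and unbounded. The
    trivial amplification matches the form of [is_convex_comb]. *)
Lemma complement Theta Phi (f : forall k, 'I_(sdim Theta k) -> 'I_(sdim Phi k)) :
  emb f -> (forall k, 2 * sdim Theta k <= sdim Phi k) ->
  exists Psi, (forall k, sdim Psi k = sdim Phi k - sdim Theta k) /\
    conjugate_reps (dsum Theta (amp Psi mult_one)) Phi.
Proof.
move=> [fi hf] dim2; pose n := sdim Theta; pose m := sdim Phi.
have e_gt0 k : 0 < m k - n k.
  by have := dim_gt0 n k; have := dim2 k; rewrite -/n -/m; lia.
have e_cvgy : (fun k => m k - n k)%N @ \oo --> \oo.
  apply/cvgnyPge => A; have /cvgnyPge/(_ A) := dim_cvgy n.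
  by apply: filterS => k; have := dim2 k; rewrite -/n -/m /=; lia.
pose e := DimSeq e_gt0 e_cvgy.
have [h hP] : exists h : forall k, 'I_(e k) -> 'I_(m k), forall k,
    [/\ injective (h k), forall x y, f k x <> h k y
    & forall z, (exists x, z = f k x) \/ (exists y, z = h k y)].
  exists (fun k => sval (cid (complement_inj (fi k)))) => k.
  by case: cid.
have hi k : injective (h k) by have [] := hP k.
have dom : dominates e (sdim Phi).
  by exists 2; apply: nearW => k /=; have := dim2 k; rewrite -/n -/m; lia.
have inv g : ae (fun k x => exists y, act Phi g k (h k x) = h k y).
  have inj_act k : injective (fun x => act Phi g k (h k x)).
    by move=> x y /perm_inj/hi.
  (* If [g] sent a point of the complement into the image of [f], then [g^-1] would bring it back
     into that image. *)
  apply: ae_sub (ae_and (ae_comp dom hi (actVK Phi g))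
    (ae_comp dom inj_act (ae_push fi (hf g^-1%g)))) _ => k x [h1 h2].
  have [_ fh hfh] := hP k; case: (hfh (act Phi g k (h k x))) => // -[y hy].
  by have := h2 _ hy; rewrite -hy h1 => /fh.
have [rho [rhoM [rho_free hE]]] := cut_down dom hi inv.
exists (rep_of_perms R rhoM rho_free); split=> //.
have eq_dim k : sdim (dsum Theta (amp (rep_of_perms R rhoM rho_free) mult_one)) k
    = sdim Phi k.
  by rewrite /= muln1; have := dim2 k; rewrite -/n -/m; lia.
have [_ [u hu]] := conjugate_emb (conjugate_amp1 (rep_of_perms R rhoM rho_free)).
apply: (emb_conjugate eq_dim); apply: (emb_join _ (conj fi hf) (emb_comp _ hu hE)).
- by apply: dominatesW => k; rewrite eq_dim.
- by apply: dominatesW => k /=; rewrite muln1.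
- by move=> k x y; have [_ fh _] := hP k; exact: fh.
Qed.

Lemma mult_two_gt0 (k : nat) : 0 < 2.
Proof. by []. Qed.

Definition mult_two : multseq := MultSeq mult_two_gt0.

Lemma emb_double Theta :
  @emb _ _ _ _ Theta (amp Theta mult_two) (fun k x => mxtens_index (x, ord0)).
Proof.
have dom : dominates (sdim Theta) (sdim (amp Theta mult_two)).
  by exists 2; apply: nearW => k /=; rewrite mulnC.
apply: (emb_of dom _ _ (act_amp Theta mult_two)) => [k x y|g|g].
- by move/(can_inj (@mxtens_indexK _ _)) => -[->].
- exact: ae_all.
- by apply: ae_all => k x; rewrite tens_permE.
Qed.

Lemma conjugate_sclass Theta Phi :
  conjugate_reps Theta Phi -> sclass Theta = sclass Phi.
Proof.
by move=> h; apply/sclassP; exists mult_one, mult_one; exact: conjugate_amp.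
Qed.

Lemma summand_convex_comb Theta Phi : summand Theta Phi ->
  exists lambda b, (0 < lambda < 1)%R /\
    is_convex_comb lambda (sclass Theta) b (sclass Phi).
Proof.
(* Doubling the ambient representation makes the weight at most 1/2, so that
   the complement is nonempty. *)
move=> [r [t [[C dom] [f hf]]]]; pose Phi2 := amp (amp Phi t) mult_two.
have hf2 := emb_comp (ex_intro _ C dom) hf (emb_double (amp Phi t)).
have dim1 k : sdim (amp Theta r) k <= sdim (amp Phi t) k.
  by have := leq_card _ (hf.1 k); rewrite !card_ord.
have dim2 k : 2 * sdim (amp Theta r) k <= sdim Phi2 k.
  by rewrite [leqRHS]/= mulnC leq_mul2r dim1 orbT.
have [Psi [dimPsi conj]] := complement hf2 dim2.
pose a k : R := ((sdim Theta k * r k)%:R /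
  (sdim Theta k * r k + sdim Psi k * mult_one k)%:R)%R.
have aE k : a k = ((sdim (amp Theta r) k)%:R / (sdim Phi2 k)%:R)%R.
  rewrite /a dimPsi [mult_one k]/= muln1 subnKC//.
  by apply: leq_trans (dim2 k); rewrite leq_pmull.
have Phi2_gt0 k : (0 < (sdim Phi2 k)%:R :> R)%R by rewrite ltr0n dim_gt0.
have a_le k : (a k <= 2^-1)%R.
  rewrite aE ler_pdivrMr// -ler_pdivrMl ?invr_gt0// invrK -natrM ler_nat.
  exact: dim2.
(* The domination constant bounds the weight below, so that its limit is not 0; [C.+1] avoids a zero
   denominator. *)
have a_ge : \forall k \near omega, ((2 * C.+1)%:R^-1 <= a k)%R.
  apply: filterS dom => k hk; rewrite aE ler_pdivlMr// ler_pdivrMl ?ltr0n//.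
  rewrite -natrM ler_nat (_ : sdim Phi2 k = 2 * sdim (amp Phi t) k); last exact: mulnC.
  rewrite -mulnA leq_mul2l /=; apply: leq_trans hk _.
  by rewrite leq_mul2r leqnSn orbT.
have [l al] : exists l : R, a @ omega --> l.
  apply: ultrafilter_cvg => k; rewrite (le_trans (a_le k)) ?andbT; last by lra.
  by rewrite aE divr_ge0.
exists l, (sclass Psi); split.
  have l_ge : ((2 * C.+1)%:R^-1 <= l)%R by exact: cvgr_to_ge al a_ge.
  have l_le : (l <= 2^-1)%R by apply: (cvgr_to_le al); exact: nearW.
  rewrite (lt_le_trans _ l_ge) ?invr_gt0 ?ltr0n//.
  by rewrite (le_lt_trans l_le)//; lra.
exists Theta, Psi, r, mult_one; split=> //.
by rewrite (conjugate_sclass conj) !sclass_amp.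
Qed.

(** Since both weights have positive limits, each term has density bounded below in the direct sum,
    and its inclusion is an embedding. *)
Lemma convex_comb_summand lambda a b c : (0 < lambda < 1)%R ->
  is_convex_comb lambda a b (c : Sof R omega G) -> forall Theta Phi,
  sclass Phi = c -> a = sclass Theta \/ b = sclass Theta -> summand Theta Phi.
Proof.
move=> /andP[l0 l1] [Theta1 [Theta2 [r [t [-> -> al ->]]]]] Theta Phi hPhi hTheta.
pose A := amp Theta1 r; pose B := amp Theta2 t.
pose n k := sdim A k; pose m k := sdim B k.
have nm0 k : (0 < (n k + m k)%:R :> R)%R by rewrite ltr0n addn_gt0 dim_gt0.
have domin (d : R) (u : nat -> nat) : (0 < d)%R ->
    (\forall k \near omega, (d <= (u k)%:R / (n k + m k)%:R)%R) ->
    dominates u (sdim (dsum A B)).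
  move=> d0 h; have [C hC] : exists C : nat, (d^-1 <= C%:R)%R.
    by exists (Num.bound d^-1); apply/ltW/archi_boundP; rewrite invr_ge0 ltW.
  exists C; apply: filterS h => k; rewrite ler_pdivlMr// -ler_pdivlMl// => h.
  by rewrite -(ler_nat R) natrM (le_trans h)// ler_wpM2r.
apply: summand_trans (sclass_summand (esym hPhi)).
case: hTheta => /esym hTheta.
  apply: summand_trans (_ : summand A _).
    by apply: sclass_summand; rewrite sclass_amp.
  have dom : dominates (sdim A) (sdim (dsum A B)).
    apply: (domin (lambda / 2)%R); first by lra.
    by apply: (cvgr_ge _ al); lra.
  by apply: embeds_summand; split=> //; eexists; exact: emb_lshift.
apply: summand_trans (_ : summand B _).
  by apply: sclass_summand; rewrite sclass_amp.
have dom : dominates (sdim B) (sdim (dsum A B)).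
  apply: (domin ((1 - lambda) / 2)%R); first by lra.
  (* The first weight is eventually at most the midpoint of [lambda] and 1, which leaves at least
     [(1 - lambda) / 2] to the second. *)
  have h : (lambda < (1 + lambda) / 2)%R by lra.
  apply: filterS (cvgr_le _ al _ h) => k.
  rewrite ler_pdivrMr ?nm0// ler_pdivlMr ?nm0// natrD => hk.
  rewrite (_ : (1 - lambda) / 2 = 1 - (1 + lambda) / 2)%R; last by lra.
  by rewrite mulrBl mul1r; move: hk; rewrite /m /=; set z := (_ * _)%R; lra.
by apply: embeds_summand; split=> //; eexists; exact: emb_rshift.
Qed.

(** [E] lives on the fibre product of [f] and [i], which fills at least half of [Delta] along
    [omega] and is almost invariant because both maps are almost equivariant. *)
Lemma pullback Delta Theta Phi
    (f : forall k, 'I_(sdim Delta k) -> 'I_(sdim Phi k))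
    (i : forall k, 'I_(sdim Theta k) -> 'I_(sdim Phi k)) :
  dominates (sdim Delta) (sdim Phi) -> emb f -> emb i ->
  (\forall k \near omega,
    sdim Delta k <= 2 * #|[set x | f k x \in codom (i k)]%SET|) ->
  exists E, embeds E Delta /\ embeds E Theta.
Proof.
move=> [C dom] [fi hf] [ii hi] half.
pose d := sdim Delta; pose n := sdim Theta; pose m := sdim Phi.
have [e0 [h [j hj]]] : exists (e : nat -> nat) (h : forall k, 'I_(e k) -> 'I_(d k))
    (j : forall k, 'I_(e k) -> 'I_(n k)), forall k,
    [/\ injective (h k), injective (j k), minn (d k) (n k) <= 2 * e k
      & d k <= 2 * #|[set x | f k x \in codom (i k)]%SET| ->
        [/\ d k <= 2 * e k, forall x, f k (h k x) = i k (j k x)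
          & forall y z, f k y = i k z -> exists x, y = h k x]].
  pose P k := cid (fibre_product (fi k) (ii k)).
  pose Q k := cid (svalP (P k)); pose S k := cid (svalP (Q k)).
  exists (fun k => sval (P k)), (fun k => sval (Q k)), (fun k => sval (S k)) => k.
  exact: svalP (S k).
have e_min k : minn (d k) (n k) <= 2 * e0 k by have [] := hj k.
have e_gt0 k : 0 < e0 k.
  by have := e_min k; have := dim_gt0 d k; have := dim_gt0 n k; lia.
have e_cvgy : e0 @ \oo --> \oo.
  apply/cvgnyPge => A; have /cvgnyPge/(_ (2 * A)) := dim_cvgy n.
  have /cvgnyPge/(_ (2 * A)) := dim_cvgy d.
  by apply: filterS2 => k /=; have := e_min k; lia.
pose e := DimSeq e_gt0 e_cvgy.
have good : \forall k \near omega, [/\ d k <= 2 * e k,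
    forall x, f k (h k x) = i k (j k x)
    & forall y z, f k y = i k z -> exists x, y = h k x].
  by apply: filterS half => k; have [] := hj k.
have domd : dominates e (sdim Delta) by exists 2; apply: filterS good => k [].
(* [Theta] is no larger than [Phi], which is at most [C] times [Delta], which is at most twice
   [e]. *)
have domn : dominates e (sdim Theta).
  exists (C * 2); apply: filterS2 dom good => k hk [hd _ _].
  have := leq_card _ (ii k); rewrite !card_ord => nm.
  by rewrite -mulnA (leq_trans nm)// (leq_trans hk)// leq_mul2l hd orbT.
have hI k : injective (h k) by have [] := hj k.
have jI k : injective (j k) by have [] := hj k.
have key g : ae (fun k x => exists y,
    act Delta g k (h k x) = h k y /\ act Theta g k (j k x) = j k y).
  have hgood : ae (fun k (x : 'I_(e k)) => (forall x, f k (h k x) = i k (j k x)) /\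
      forall y z, f k y = i k z -> exists x, y = h k x).
    by apply: ae_near; apply: filterS good => k [_ h1 h2].
  apply: ae_sub (ae_and hgood
    (ae_and (ae_comp domd hI (hf g)) (ae_comp domn jI (hi g)))) _.
  (* The images of [h k x] and [j k x] under [g] have the same image in [Phi], so they form a point
     [y] of the fibre product. *)
  move=> k x [[fh lift] [h1 h2]]; rewrite fh -h2 in h1.
  have [y hy] := lift _ _ h1; exists y; split=> //.
  by apply: (ii k); rewrite -h1 hy fh.
have [|rho [rhoM [rho_free hE]]] := @cut_down _ _ _ _ Delta e h domd hI.
  by move=> g; apply: ae_sub (key g) _ => k x [y []]; exists y.
exists (rep_of_perms R rhoM rho_free); split; first by split=> //; exists h.
split=> //; exists j; split=> // g.
apply: (ae_sub (ae_and (hE.2 g) (key g))) => k x [h1 [y [h2 ->]]].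
by congr (j k _); apply: (hI k); rewrite h1.
Qed.

(** The two terms cover the image of an amplification of [Delta], so one of them receives at least
    half of it along [omega], and [pullback] applies to its inclusion. *)
Lemma summand_dsum Delta Theta Psi : summand Delta (dsum Theta Psi) ->
  exists E, summand E Delta /\ (summand E Theta \/ summand E Psi).
Proof.
have to_summand E Phi r : embeds E (amp Phi r) -> summand E Phi.
  move=> h; apply: summand_trans (embeds_summand h) _.
  by apply: sclass_summand; rewrite sclass_amp.
move=> [r [t hD]]; have [dom [f hf]] := embeds_trans hD (amp_dsum Theta Psi t).
set D := amp Delta r in hD dom f hf.
set A := amp Theta t in f hf dom; set B := amp Psi t in f hf dom.
pose il k (x : 'I_(sdim A k)) := lshift (sdim B k) x.
pose ir k (x : 'I_(sdim B k)) := rshift (sdim A k) x.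
pose SA k := [set x | f k x \in codom (@il k)]%SET.
pose SB k := [set x | f k x \in codom (@ir k)]%SET.
have cover k : sdim D k <= #|SA k| + #|SB k|.
  rewrite -[leqLHS]card_ord -cardsT; apply: leq_trans (leq_card_setU _ _).
  apply: subset_leq_card; apply/fintype.subsetP => x _; rewrite !inE.
  by case: (split_ordP (f k x)) => y ->; rewrite codom_f ?orbT.
(* A term of the sum may be negligible, but one receiving half of [D] has positive density, so its
   inclusion is almost equivariant. *)
have half (u : nat -> nat) (S : forall k, {set 'I_(sdim D k)}) :
    (forall k, #|S k| <= u k) ->
    (\forall k \near omega, sdim D k <= 2 * #|S k|) ->
    dominates u (sdim (dsum A B)).
  move=> Su hS; apply: dominates_trans dom; exists 2; apply: filterS hS => k hk.
  by apply: leq_trans hk _; rewrite leq_mul2l Su.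
have cSA k : #|SA k| <= sdim A k.
  by have := card_preim_codom (@il k) (hf.1 k); rewrite card_ord.
have cSB k : #|SB k| <= sdim B k.
  by have := card_preim_codom (@ir k) (hf.1 k); rewrite card_ord.
(* The ultrafilter decides which of the two terms is used. *)
have [hA|hB] := in_ultra_setVsetC [set k | sdim D k <= 2 * #|SA k|] omegaU.
  have [E [ED EA]] := pullback dom hf (emb_lshift (half _ _ cSA hA)) hA.
  by exists E; split; [exact: to_summand ED|left; exact: to_summand EA].
have {}hB : \forall k \near omega, sdim D k <= 2 * #|SB k|.
  apply: filterS hB => k /negP; rewrite -ltnNge; have := cover k; lia.
have [E [ED EB]] := pullback dom hf (emb_rshift (half _ _ cSB hB)) hB.
by exists E; split; [exact: to_summand ED|right; exact: to_summand EB].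
Qed.

Lemma sclass_repr (c : Sof R omega G) : exists Phi, c = sclass Phi.
Proof. by exists (repr c); rewrite /sclass reprK. Qed.

Definition supported_on (S : set (soficRep R omega G)) : set (Sof R omega G) :=
  [set c | forall Delta Phi, c = sclass Phi -> summand Delta Phi ->
    exists2 Theta, S Theta & summand Theta Delta].

(** A summand has a coefficient strictly between 0 and 1 in a decomposition, to which extremality
    applies. *)
Lemma extreme_summand Theta Delta : extreme_point (sclass Theta) ->
  summand Delta Theta -> sclass Delta = sclass Theta.
Proof.
by move=> ext /summand_convex_comb[l [b [l01 hb]]]; have [] := ext _ _ _ l01 hb.
Qed.

Lemma face_supported_on (S : set (soficRep R omega G)) :
  S !=set0 -> (forall Theta, S Theta -> extreme_point (sclass Theta)) ->
  is_face (supported_on S).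
Proof.
move=> [Theta0 S0] ext; split.
- exists (sclass Theta0) => Delta Phi hPhi hD; exists Theta0 => //.
  apply: sclass_summand; apply/esym/extreme_summand; first exact: ext.
  exact: summand_trans hD (sclass_summand (esym hPhi)).
- move=> lambda a b c _ [Theta [Psi [r [t [-> -> _ ->]]]]] ha hb Delta Phi hPhi hD.
  (* [Delta] shares the summand [E] with one term; the element of [S] found below [E] is also below
     [Delta]. *)
  have [E [ED EAB]] := summand_dsum (summand_trans hD (sclass_summand (esym hPhi))).
  case: EAB => [EA|EB].
    have [|Xi SXi hXi] := ha E (amp Theta r) _ EA; first by rewrite sclass_amp.
    by exists Xi => //; exact: summand_trans hXi ED.
  have [|Xi SXi hXi] := hb E (amp Psi t) _ EB; first by rewrite sclass_amp.
  by exists Xi => //; exact: summand_trans hXi ED.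
move=> lambda a b c l01 comb hc; have [Phi hPhi] := sclass_repr c.
have hs := convex_comb_summand l01 comb (esym hPhi).
split=> Delta Xi hXi hD; apply: (hc Delta Phi hPhi); apply: summand_trans hD _.
  by apply: hs; left.
by apply: hs; right.
Qed.

End Riesz.

(** * Faces supported on the tails of the sequence *)

Theorem theorem4p2 (R : realType) (omega : set_system nat)
    (omega_ultra : UltraFilter omega)
    (omega_free : \bigcap_(A in omega) A = set0)
    (G : groupType) (G_countable : countable [set: G])
    (Theta : nat -> soficRep R omega G)
    (Theta_distinct : forall i j, i <> j -> sclass (Theta i) <> sclass (Theta j))
    (Theta_extreme : forall i, extreme_point (sclass (Theta i))) :
  exists F : nat -> set (Sof R omega G),
    [/\ forall j, is_face (F j),
        forall j, F j.+1 `<=` F j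
      & \bigcap_j F j = set0].
Proof.
exists (fun j => supported_on [set Theta i | i in [set i | j <= i]]); split.
- move=> j; apply: face_supported_on; first by exists (Theta j), j => /=.
  by move=> _ [i _ <-].
- move=> j c hc Delta Phi hPhi hD; have [_ [i ji <-] hi] := hc Delta Phi hPhi hD.
  by exists (Theta i) => //; exists i => //; exact: ltnW.
rewrite -subset0 => c hc; have [Phi hPhi] := sclass_repr c.
have [_ [i _ <-] hi] := hc 0 I Phi Phi hPhi (sclass_summand erefl).
(* The face of index [i.+1] forces [i'] to be strictly larger than [i]. *)
have [_ [i' ii' <-] hi'] := hc i.+1 I (Theta i) Phi hPhi hi.
apply: (Theta_distinct i' i); first by move=> ii; rewrite /= ii ltnn in ii'.
exact: extreme_summand.
Qed.
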